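(* Let $K$ be an algebraically closed field, let $e=\mathrm{char}(K)$ if $\mathrm{char}(K)>0$ and $e=\infty$ otherwise, let $n\ge0$ and $r\ge1$ be integers and let $\mathbf s=(s_1,\dots,s_r)\in\mathbb Z^r$ with $0\le s_1\le\dots\le s_r<e$. Let $M\ne0$ be a module of the degenerate cyclotomic Hecke algebra $\mathbf h_n^{\mathbf s}$. Then the induced module $\mathrm{Ind}_{\mathbf h_n^{\mathbf s}}^{\mathbf h_{n+1}^{\mathbf s}}(M)$ has at least $r+1$ constituents. In particular, it is reducible.
   Context: For a non-negative integer $n$, the degenerate affine Hecke algebra $\mathbf h_n$ over $K$ is, as a vector space, $K[x_1,\dots,x_n]\otimes K[\mathfrak S_n]$, where $\mathfrak S_n$ is the symmetric group on $n$ letters, with multiplication such that $K[x_1,\dots,x_n]\otimes1$ and $1\otimes K[\mathfrak S_n]$ are subalgebras and, with $s_i=(i,i+1)\in\mathfrak S_n$ (the $i$-th Coxeter generator, not to be confused with the entries of $\mathbf s$): $s_ix_j=x_js_i$ if $j\ne i,i+1$, $s_ix_{i+1}=x_is_i+1$, $x_{i+1}s_i=s_ix_i+1$. For $\mathbf s=(s_1,\dots,s_r)$ the degenerate cyclotomic Hecke algebra is $\mathbf h_n^{\mathbf s}=\mathbf h_n/\langle(x_1-s_1)\cdots(x_1-s_r)\rangle$ (quotient by the two-sided ideal; the integers $s_j$ are viewed in $K$; for $n=0$ this is understood as the trivial algebra $K$). $\mathbf h_n^{\mathbf s}$ embeds naturally into $\mathbf h_{n+1}^{\mathbf s}$, and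 $\mathrm{Ind}_{\mathbf h_n^{\mathbf s}}^{\mathbf h_{n+1}^{\mathbf s}}(M)=M\otimes_{\mathbf h_n^{\mathbf s}}\mathbf h_{n+1}^{\mathbf s}$, which is exact in $M$. Modules are finite-dimensional right modules; constituents are composition factors, counted with multiplicity.
   Formalization: The formal theorem assumes n ≥ 1 instead of n ≥ 0: for n = 0 and M = K the induced module K[x_1]/∏(x_1 − s_j) has dimension r, hence exactly r constituents (and is simple when r = 1), so the claim fails there. *)

(* Defs.v *)
From HB Require Import structures.
From mathcomp Require Import all_boot all_order all_fingroup all_algebra.
From mathcomp Require Import boolp.
From mathcomp Require Import generic_quotient mpoly freeg.

Set Implicit Arguments.
Unset Strict Implicit.
Unset Printing Implicit Defensive.

Import Order.TTheory GRing.Theory Num.Theory.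
Local Open Scope ring_scope.
Local Open Scope quotient_scope.

(* MathComp's ring quotients are limited to commutative rings. The quotient   *)
(* below is only a [pzRingType]: that it is nontrivial is a theorem, not part *)
(* of the construction.                                                       *)

Definition ideal2 (R : pzRingType) (I : {pred R}) : Prop :=
  zmod_closed I /\ forall a x : R, x \in I -> a * x \in I /\ x * a \in I.

Definition ideal_gen (R : pzRingType) (G : R -> Prop) : {pred R} :=
  fun x => `[< forall I : {pred R},
                 ideal2 I -> (forall g, G g -> g \in I) -> x \in I >].

Section RingQuotient.
Variables (R : pzRingType) (G : R -> Prop).

Lemma ideal_gen_sub g : G g -> g \in ideal_gen G.
Proof. by move=> Gg; apply/asboolP => I _; apply. Qed.

Lemma ideal_gen_zmod_closed : zmod_closed (ideal_gen G).
Proof.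
split; first by apply/asboolP => I [[I0 _] _] _.
move=> x y /asboolP Ix /asboolP Iy; apply/asboolP => I II GI.
by apply: II.1.2; [apply: Ix | apply: Iy].
Qed.

HB.instance Definition _ :=
  GRing.isZmodClosed.Build R (ideal_gen G) ideal_gen_zmod_closed.

Lemma ideal_genMl a x : x \in ideal_gen G -> a * x \in ideal_gen G.
Proof.
by move=> /asboolP Ix; apply/asboolP => I II GI; apply: (II.2 _ _ _).1; apply: Ix.
Qed.

Lemma ideal_genMr a x : x \in ideal_gen G -> x * a \in ideal_gen G.
Proof.
by move=> /asboolP Ix; apply/asboolP => I II GI; apply: (II.2 _ _ _).2; apply: Ix.
Qed.

Definition ring_quot := Quotient.quot (ideal_gen G).
HB.instance Definition _ := GRing.Zmodule.on ring_quot.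

Definition rq_pi (x : R) : ring_quot := \pi_(Quotient.quot (ideal_gen G)) x.
Definition rq_repr (a : ring_quot) : R := repr (a : Quotient.quot (ideal_gen G)).

Lemma rq_reprK a : rq_pi (rq_repr a) = a.
Proof. exact: reprK. Qed.

Lemma rq_piP x y : reflect (rq_pi x = rq_pi y) (x - y \in ideal_gen G).
Proof. by rewrite Quotient.idealrBE; apply: eqP. Qed.

Lemma rq_piB : zmod_morphism rq_pi.
Proof. by move=> x y; rewrite /rq_pi; rewrite !piE. Qed.

HB.instance Definition _ := GRing.isZmodMorphism.Build R ring_quot rq_pi rq_piB.

Definition rq_mul (a b : ring_quot) : ring_quot := rq_pi (rq_repr a * rq_repr b).

Lemma rq_piM x y : rq_pi (x * y) = rq_mul (rq_pi x) (rq_pi y).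
Proof.
apply/rq_piP; set x' := rq_repr _; set y' := rq_repr _.
have -> : x * y - x' * y' = x * (y - y') + (x - x') * y'.
  by rewrite mulrBr mulrBl addrA subrK.
by apply: rpredD; [apply: ideal_genMl | apply: ideal_genMr];
   apply/rq_piP; rewrite rq_reprK.
Qed.

Lemma rq_mulA : associative rq_mul.
Proof.
by move=> a b c; rewrite -[a]rq_reprK -[b]rq_reprK -[c]rq_reprK -!rq_piM mulrA.
Qed.

Lemma rq_mul1l : left_id (rq_pi 1) rq_mul.
Proof. by move=> a; rewrite -[a]rq_reprK -rq_piM mul1r. Qed.

Lemma rq_mul1r : right_id (rq_pi 1) rq_mul.
Proof. by move=> a; rewrite -[a]rq_reprK -rq_piM mulr1. Qed.

Lemma rq_mulDl : left_distributive rq_mul +%R.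
Proof.
move=> a b c; rewrite -[a]rq_reprK -[b]rq_reprK -[c]rq_reprK.
by rewrite -raddfD -!rq_piM mulrDl raddfD.
Qed.

Lemma rq_mulDr : right_distributive rq_mul +%R.
Proof.
move=> a b c; rewrite -[a]rq_reprK -[b]rq_reprK -[c]rq_reprK.
by rewrite -raddfD -!rq_piM mulrDr raddfD.
Qed.

HB.instance Definition _ := GRing.Zmodule_isPzRing.Build ring_quot
  rq_mulA rq_mul1l rq_mul1r rq_mulDl rq_mulDr.

Lemma rq_pi_monoid : monoid_morphism rq_pi.
Proof. by split => // x y; rewrite rq_piM. Qed.

HB.instance Definition _ :=
  GRing.isMonoidMorphism.Build R ring_quot rq_pi rq_pi_monoid.

End RingQuotient.

(* Right modules over [A] are left modules over the converse ring [A^c].      *)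

Definition ract (A : pzRingType) (M : lmodType A^c) (m : M) (a : A) : M :=
  (a : A^c) *: m.

(* The induced module M (x)_A B along f : A -> B: the free abelian group on   *)
(* M x B modulo the usual relations, with B acting on the second factor.      *)

Definition zspan (V : zmodType) (G : V -> Prop) : {pred V} :=
  fun x => `[< forall U : {pred V},
                 zmod_closed U -> (forall g, G g -> g \in U) -> x \in U >].

Section ZSpan.
Variables (V : zmodType) (G : V -> Prop).

Lemma zspan_sub g : G g -> g \in zspan G.
Proof. by move=> Gg; apply/asboolP => I _; apply. Qed.

Lemma zspan_zmod_closed : zmod_closed (zspan G).
Proof.
split; first by apply/asboolP => U [U0 _] _.
move=> x y /asboolP Ux /asboolP Uy; apply/asboolP => U UU GU.
by apply: UU.2; [apply: Ux | apply: Uy].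
Qed.

HB.instance Definition _ :=
  GRing.isZmodClosed.Build V (zspan G) zspan_zmod_closed.
End ZSpan.

Section Induction.
Variables (A B : pzRingType) (f : A -> B) (M : lmodType A^c).

Local Notation F := {freeg (M * B)%type / int}.
Local Notation gen m b := (<< (m, b) >> : F).

Inductive tensor_rel : F -> Prop :=
| TensorAddl m m' b : tensor_rel (gen (m + m') b - gen m b - gen m' b)
| TensorAddr m b b' : tensor_rel (gen m (b + b') - gen m b - gen m b')
| TensorBal m a b : tensor_rel (gen (ract m a) b - gen m (f a * b)).

Definition Ind := Quotient.quot (zspan tensor_rel).
HB.instance Definition _ := GRing.Zmodule.on Ind.

Definition ind_pi (x : F) : Ind := \pi_(Quotient.quot (zspan tensor_rel)) x.
Definition ind_repr (t : Ind) : F := repr (t : Quotient.quot (zspan tensor_rel)).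

Definition tens (m : M) (b : B) : Ind := ind_pi (gen m b).

Definition free_act (c : B) : F -> F := fglift (fun p => gen p.1 (p.2 * c)).

Definition ind_scale (c : B^c) (t : Ind) : Ind := ind_pi (free_act c (ind_repr t)).

Lemma ind_reprK t : ind_pi (ind_repr t) = t.
Proof. exact: reprK. Qed.

Lemma ind_piP x y : reflect (ind_pi x = ind_pi y) (x - y \in zspan tensor_rel).
Proof. by rewrite Quotient.idealrBE; apply: eqP. Qed.

Lemma ind_piB : zmod_morphism ind_pi.
Proof. by move=> x y; rewrite /ind_pi !piE. Qed.

HB.instance Definition _ := GRing.isZmodMorphism.Build F Ind ind_pi ind_piB.

Lemma free_act_is_zmod c : zmod_morphism (free_act c).
Proof. exact: lift_is_additive. Qed.

HB.instance Definition _ c := GRing.isZmodMorphism.Build F F (free_act c) (free_act_is_zmod c).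

Lemma free_act_gen c m b : free_act c (gen m b) = gen m (b * c).
Proof. by rewrite /free_act liftU scale1r. Qed.

Lemma free_ind (P : F -> Prop) :
  (forall m b, P (gen m b)) -> P 0 -> (forall x y, P x -> P y -> P (x - y)) ->
  forall x, P x.
Proof.
move=> Pg P0 PB x.
have PN y : P y -> P (- y) by move=> Py; rewrite -sub0r; apply: PB.
have PD y z : P y -> P z -> P (y + z).
  by move=> Py Pz; rewrite -[z]opprK; apply: PB => //; apply: PN.
have PM y k : P y -> P (y *+ k).
  by move=> Py; elim: k => [|k IH]; rewrite ?mulr0n // mulrS; apply: PD.
rewrite -[x]freeg_sumE; apply: big_ind => // -[m b] _.
have -> : << coeff (m, b) x *g (m, b) >> = gen m b *~ coeff (m, b) x :> F.
  by rewrite freegU_mulz intz.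
case: (coeff _ _) => k; first exact: PM (Pg m b).
by rewrite NegzE mulrNz; apply/PN/(PM _ k.+1)/Pg.
Qed.

Lemma free_act_zspan c x : x \in zspan tensor_rel -> free_act c x \in zspan tensor_rel.
Proof.
pose U : {pred F} := fun y => free_act c y \in zspan tensor_rel.
have UE y : (y \in U) = (free_act c y \in zspan tensor_rel) by [].
move=> /asboolP /(_ U); rewrite UE; apply.
  split=> [|y z]; first by rewrite UE raddf0 rpred0.
  by rewrite !UE free_act_is_zmod => Uy Uz; apply: rpredB.
move=> _ [m m' b | m b b' | m a b]; rewrite UE !free_act_is_zmod !free_act_gen;
  apply: zspan_sub.
- exact: TensorAddl.
- by rewrite mulrDl; apply: TensorAddr.
by rewrite -mulrA; apply: TensorBal.
Qed.

Lemma ind_scale_pi c x : ind_scale c (ind_pi x) = ind_pi (free_act c x).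
Proof.
by apply/ind_piP; rewrite -free_act_is_zmod free_act_zspan //; apply/ind_piP; rewrite ind_reprK.
Qed.

Lemma tens_scale c m b : ind_scale c (tens m b) = tens m (b * c).
Proof. by rewrite ind_scale_pi free_act_gen. Qed.

Lemma tensDl m m' b : tens (m + m') b = tens m b + tens m' b.
Proof.
by rewrite -raddfD; apply/ind_piP; rewrite opprD addrA; apply: zspan_sub; exact: TensorAddl.
Qed.

Lemma tensDr m b b' : tens m (b + b') = tens m b + tens m b'.
Proof.
by rewrite -raddfD; apply/ind_piP; rewrite opprD addrA; apply: zspan_sub; exact: TensorAddr.
Qed.

Lemma tens_bal m a b : tens (ract m a) b = tens m (f a * b).
Proof. by apply/ind_piP; apply: zspan_sub; exact: TensorBal. Qed.

Lemma ind_scaleB c : zmod_morphism (ind_scale c).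
Proof.
move=> t u; rewrite -[t]ind_reprK -[u]ind_reprK -ind_piB !ind_scale_pi.
by rewrite free_act_is_zmod ind_piB.
Qed.

HB.instance Definition _ c :=
  GRing.isZmodMorphism.Build Ind Ind (ind_scale c) (ind_scaleB c).

Lemma ind_tens_ind (P : Ind -> Prop) :
  (forall m b, P (tens m b)) -> P 0 -> (forall t u, P t -> P u -> P (t - u)) ->
  forall t, P t.
Proof.
move=> Pg P0 PB t; rewrite -[t]ind_reprK; elim/free_ind: (ind_repr t) => //.
  by rewrite raddf0.
by move=> x y Px Py; rewrite raddfB; apply: PB.
Qed.

Lemma ind_scaleA (c d : B^c) t : ind_scale c (ind_scale d t) = ind_scale (c * d) t.
Proof.
elim/ind_tens_ind: t => [m b||t u Pt Pu].
- by rewrite !tens_scale -mulrA.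
- by rewrite !raddf0.
by rewrite !raddfB /= Pt Pu.
Qed.

Lemma ind_scale1 : left_id 1 ind_scale.
Proof.
move=> t; elim/ind_tens_ind: t => [m b||t u Pt Pu].
- by rewrite tens_scale mulr1.
- by rewrite raddf0.
by rewrite raddfB /= Pt Pu.
Qed.

Lemma ind_scaleDr : right_distributive ind_scale +%R.
Proof. by move=> c t u; rewrite raddfD. Qed.

Lemma ind_scaleDl t : {morph ind_scale^~ t : c d / c + d}.
Proof.
move=> c d; elim/ind_tens_ind: t => [m b||t u Pt Pu].
- by rewrite !tens_scale -tensDr -mulrDr.
- by rewrite !raddf0 addr0.
by rewrite !raddfB /= Pt Pu opprD addrACA.
Qed.

HB.instance Definition _ := GRing.Zmodule_isLmodule.Build B^c Ind
  ind_scaleA ind_scale1 ind_scaleDr ind_scaleDl.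

Lemma tens_act m b c : ract (tens m b) c = tens m (b * c).
Proof. exact: tens_scale. Qed.

End Induction.

Section CompositionSeries.
Variables (R : pzRingType) (V : lmodType R).

(* [W / U] is a simple module *)
Definition simple_factor (U W : {pred V}) : Prop :=
  [/\ {subset U <= W}, ~ {subset W <= U} &
      forall X : {pred V}, submod_closed X ->
        {subset U <= X} -> {subset X <= W} ->
        {subset X <= U} \/ {subset W <= X}].

Definition composition_series (k : nat) (U : nat -> {pred V}) : Prop :=
  [/\ forall i, (i <= k)%N -> submod_closed (U i),
      U 0%N =i pred1 0,
      U k =i predT &
      forall i, (i < k)%N -> simple_factor (U i) (U i.+1)].

(* By Jordan-Hoelder the number of constituents, counted with multiplicity,   *)
(* is the length of any composition series.                                   *)
Definition nb_constituents (k : nat) : Prop :=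
  exists U, composition_series k U.

Definition reducible : Prop :=
  exists U : {pred V},
    [/\ submod_closed U, exists2 u, u \in U & u != 0 & exists v, v \notin U].

End CompositionSeries.

(* [daha K n] collects the realizations of the degenerate affine Hecke        *)
(* algebra h_n. [daha_basis] says that multiplication                         *)
(* K[x_1, ..., x_n] (x) K[S_n] -> H is a linear isomorphism; this and the     *)
(* relations determine [H] up to unique isomorphism. Variables are numbered   *)
(* from 0, and the i-th Coxeter generator is [tperm i j] with [j = i + 1].    *)
(* Permutations compose from left to right in MathComp; the opposite choice   *)
(* gives the same algebras, via [w |-> w^-1].                                 *)

Record daha (K : fieldType) (n : nat) := Daha {
  daha_alg :> algType K;
  daha_pol : {lrmorphism {mpoly K[n]} -> daha_alg};
  daha_perm : 'S_n -> daha_alg;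
  daha_perm1 : daha_perm 1%g = 1;
  daha_permM : forall v w, daha_perm (v * w)%g = daha_perm v * daha_perm w;
  daha_basis : bijective (fun c : {ffun 'S_n -> {mpoly K[n]}} =>
                            \sum_w daha_pol (c w) * daha_perm w);
  daha_comm : forall i j k : 'I_n, j = i.+1 :> nat -> k != i -> k != j ->
    daha_perm (tperm i j) * daha_pol 'X_k = daha_pol 'X_k * daha_perm (tperm i j);
  daha_cross : forall i j : 'I_n, j = i.+1 :> nat ->
    daha_perm (tperm i j) * daha_pol 'X_j = daha_pol 'X_i * daha_perm (tperm i j) + 1;
  daha_cross' : forall i j : 'I_n, j = i.+1 :> nat ->
    daha_pol 'X_j * daha_perm (tperm i j) = daha_perm (tperm i j) * daha_pol 'X_i + 1
}.

Section Daha.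
Variable K : fieldType.

Definition daha_elt n (H : daha K n) (c : {ffun 'S_n -> {mpoly K[n]}}) : H :=
  \sum_w daha_pol H (c w) * daha_perm H w.

Lemma daha_coord_subproof n (H : daha K n) (h : H) :
  exists c, daha_elt H c == h.
Proof. by case: (daha_basis H) => g _ gK; exists (g h); apply/eqP/gK. Qed.

Definition daha_coord n (H : daha K n) (h : H) : {ffun 'S_n -> {mpoly K[n]}} :=
  xchoose (daha_coord_subproof h).

(* [x_i |-> x_i], and [w] is extended by fixing the last letter *)
Definition daha_incl n (H : daha K n) (H' : daha K n.+1) (h : H) : H' :=
  \sum_w daha_pol H' (mwiden (daha_coord h w)) *
         daha_perm H' (lift_perm ord_max ord_max w).

Variables (r : nat) (s : 'I_r -> int).

(* For n = 0 there is no first variable and no relation is imposed *)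
Definition cyclotomic_rel n (H : daha K n) (h : H) : Prop :=
  exists2 i : 'I_n, i = 0%N :> nat &
    h = \prod_(j < r) (daha_pol H 'X_i - (s j)%:~R).

Definition cyclotomic n (H : daha K n) : pzRingType :=
  ring_quot (@cyclotomic_rel n H).

Definition cyclotomic_scalar n (H : daha K n) (k : K) : cyclotomic H :=
  rq_pi (@cyclotomic_rel n H) k%:A.

Definition cyclotomic_incl n (H : daha K n) (H' : daha K n.+1)
    (a : cyclotomic H) : cyclotomic H' :=
  rq_pi (@cyclotomic_rel n.+1 H') (daha_incl H' (rq_repr a)).

Definition finite_dimensional n (H : daha K n) (M : lmodType (cyclotomic H)^c) :=
  exists (d : nat) (v : 'I_d -> M), forall m : M, exists c : 'I_d -> K,
    m = \sum_(i < d) ract (v i) (cyclotomic_scalar H (c i)).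

End Daha.

(* [m < e], where [e] is the characteristic of [K] if positive, else infinity *)
Definition lt_char (K : fieldType) (m : int) : Prop :=
  forall p : nat, p \in [pchar K] -> m < p%:Z.

(* Main.v *)
(* Let f = (x_1 - s_1)...(x_1 - s_r), let t be the transposition (1, n+1), and *)
(* let F = t f t, which lies in the cyclotomic ideal of h_{n+1}. Write         *)
(* T = x_{n+1}. As a left h_n-module, h_{n+1} is free on the T^a e_k, e_k      *)
(* being coset representatives of S_n in S_{n+1}, and                          *)
(*   F = T^r - T^{r-1} s_n + (other terms of degree < r in T),   n >= 1.       *)
(* Dividing by the "monic" F yields a left h_n-linear map c : h_{n+1} -> h_n,  *)
(* the coefficient of T^{r-1} s_n in the remainder, with c(T^a) = 0 for a < r  *)
(* and, thanks to the term - T^{r-1} s_n, c(T^r) = 1. It maps the cyclotomic   *)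
(* ideal to the cyclotomic ideal, so m (x) b |-> m c(b) is defined on Ind M.   *)
(*   Left multiplication by T is an endomorphism X of Ind M. If p is monic of  *)
(* degree at most r then p(X) != 0: after multiplying p by a power of T, c     *)
(* sends p(T) to 1. Since the characteristic polynomial of a lift of X splits, *)
(* the images of the successive products of the X - a_i descend from Ind M to  *)
(* 0, and more than r of these inclusions are strict.                          *)

Require Import Defs.
From HB Require Import structures.
From mathcomp Require Import freeg.
From mathcomp Require Import all_boot all_order all_fingroup all_algebra.
From mathcomp Require Import boolp.
From mathcomp Require Import mpoly.

Set Implicit Arguments.
Unset Strict Implicit.
Unset Printing Implicit Defensive.

Import Order.TTheory GRing.Theory Num.Theory.
Local Open Scope ring_scope.

(** Let X be left multiplication by T = x_{n+1} on Ind M. No monic polynomial of degree at most r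
    annihilates X, whereas its characteristic polynomial on a finite-dimensional cover splits and
    does. Applying the factors X - a_i one by one therefore shrinks the image strictly more than r
    times, and each strict inclusion of submodules contributes at least one constituent
    ([shift_prod_annihilator], [shift_chain], [many_constituents]).

    Nonvanishing of p(X) is detected by a left linear map tr from the cyclotomic quotient of h_{n+1}
    to that of h_n, with tr(p(T)) = 1 for every monic p of degree r ([exists_cyclotomic_trace]): m
    (x) b |-> m tr(b) is then well defined and sends p(X)(m (x) 1) to m ([shift_prod_neq0]). The
    value 1 is forced by the term - T^{r-1} s_n of F ([conj_cyc_lowerS]). This term needs n >= 1;
    for n = 0 inducing K gives K[x_1]/(f), with only r constituents.

    The map c behind tr is built by recursion on the power of T so that c(T^a F w) = 0
    ([exists_cyclotomic_functional]). That it respects the whole two-sided ideal is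
    [functional_cyc_ideal]: x_1 passes through F up to multiples of f ([conj_cycX0]), the other
    early variables follow by conjugation, and T follows because the sum of all variables is central
    ([daha_sumXC]). *)

(** * Permutations and polynomials *)

Lemma perm_adj_ind n (P : 'S_n -> Prop) :
  P 1%g ->
  (forall i j : 'I_n, j = i.+1 :> nat -> forall w, P w -> P (tperm i j * w)%g) ->
  forall w, P w.
Proof.
(* [G] is a submonoid containing the adjacent transpositions. A longer transposition is conjugate,
   by an adjacent one, to a transposition with a smaller gap. *)
move=> P1 Padj; pose G (w : 'S_n) := forall v, P v -> P (w * v)%g.
have GM u v : G u -> G v -> G (u * v)%g.
  by move=> Gu Gv w Pw; rewrite -mulgA; apply/Gu/Gv.
have Glt k (i j : 'I_n) : j = (i + k).+1 :> nat -> G (tperm i j).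
  elim: k j => [|k IHk] j; first by rewrite addn0; apply: Padj.
  rewrite addnS => ej.
  have lt_j' : ((i + k).+1 < n)%N by rewrite -ej ltnW // ltn_ord.
  pose j' := Ordinal lt_j'.
  have -> : tperm i j = (tperm j' j * tperm i j' * tperm j' j)%g.
    have -> : tperm i j = (tperm i j' ^ tperm j' j)%g.
      rewrite tpermJ tpermL tpermD // -val_eqE /= ?ej.
        by rewrite gtn_eqF // ltnS leq_addr.
      by rewrite gtn_eqF // ltnS leqW // leq_addr.
    by rewrite /conjg tpermV mulgA.
  by apply/GM/Padj => //; apply/GM/IHk => //; apply: Padj.
have Gt i j : G (tperm i j).
  case: (ltngtP i j) => [lt_ij|lt_ji|/ord_inj->].
  - by apply: (Glt (j - i.+1)%N); rewrite -addSn subnKC.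
  - by rewrite tpermC; apply: (Glt (i - j.+1)%N); rewrite -addSn subnKC.
  by rewrite tperm1 => v; rewrite mul1g.
move=> w; rewrite -[w]mulg1.
suff: G w by apply.
have [ts -> _] := prod_tpermP w.
by elim/big_ind: _ => // v; rewrite mul1g.
Qed.

Lemma perm_adj_ind_r n (P : 'S_n -> Prop) :
  P 1%g ->
  (forall i j : 'I_n, j = i.+1 :> nat -> forall w, P w -> P (w * tperm i j)%g) ->
  forall w, P w.
Proof.
move=> P1 Padj w; rewrite -[w]invgK; move: (w^-1)%g.
apply: perm_adj_ind => [|i j ij v Pv]; first by rewrite invg1.
by rewrite invMg tpermV; apply: Padj.
Qed.

Lemma perm_fix_lift n (l : 'I_n.+1) (w : 'S_n.+1) :
  w l = l -> exists u, w = lift_perm l l u.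
Proof.
move=> wl; have wlift i : w (lift l i) != l.
  by rewrite -[X in _ != X]wl (inj_eq perm_inj) eq_sym neq_lift.
pose g i := odflt i (unlift l (w (lift l i))).
have gP i : w (lift l i) = lift l (g i).
  by rewrite /g; case: unliftP (wlift i) => [j|] -> //=; rewrite eqxx.
have g_inj : injective g.
  by move=> i j gij; apply/(@lift_inj _ l)/(@perm_inj _ w); rewrite !gP gij.
exists (perm g_inj); apply/permP=> i; case: (unliftP l i) => [j|] ->.
  by rewrite lift_perm_lift gP permE.
by rewrite lift_perm_id.
Qed.

Lemma lift_perm_tperm n (l : 'I_n.+1) (i j : 'I_n) :
  lift_perm l l (tperm i j) = tperm (lift l i) (lift l j).
Proof.
apply/permP=> x; case: (unliftP l x) => [y|] ->.
  by rewrite lift_perm_lift (inj_tperm _ _ _ (@lift_inj _ l)).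
by rewrite lift_perm_id tpermD // eq_sym neq_lift.
Qed.

Lemma perm_coset n (w : 'S_n.+1) :
  exists u, w = (lift_perm ord_max ord_max u * tperm ord_max (w ord_max))%g.
Proof.
have [|u uP] := @perm_fix_lift n ord_max (w * tperm ord_max (w ord_max))%g.
  by rewrite permM tpermR.
by exists u; rewrite -uP -mulgA tperm2 mulg1.
Qed.

Lemma mpoly_ind_mulX (K : comNzRingType) n (P : {mpoly K[n]} -> Prop) :
  (forall p q, P p -> P q -> P (p + q)) ->
  (forall c p, P p -> P (c *: p)) -> P 1 ->
  (forall i p, P p -> P ('X_i * p)) -> forall p, P p.
Proof.
move=> PD PZ P1 PX.
elim/mpolyind => [|c m p _ _ Pp]; first by rewrite -(scale0r 1); apply: PZ.
apply: PD => //; apply: PZ; rewrite mpolyXE_id.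
pose G (q : {mpoly K[n]}) := forall p, P p -> P (q * p).
suff: G (\prod_i 'X_i ^+ m i) by rewrite -[X in P X]mulr1; apply.
elim/big_ind: _ => [q||i _]; first by rewrite mul1r.
  by move=> q1 q2 G1 G2 q Pq; rewrite -mulrA; apply/G1/G2.
by elim: (m i) => [|k IHk] q Pq; rewrite ?mul1r // exprS -mulrA; apply/PX/IHk.
Qed.

Lemma mpoly_ind_last (K : comNzRingType) n (P : {mpoly K[n.+1]} -> Prop) :
  (forall p q, P p -> P q -> P (p + q)) ->
  (forall p a, P (mwiden p * 'X_ord_max ^+ a)) -> forall p, P p.
Proof.
move=> PD PX; elim/mpolyind => [|c m p _ _ Pp].
  by have := PX 0 0%N; rewrite raddf0 mul0r.
apply: PD => //; rewrite mpolyXE_id big_ord_recr /= scalerAl.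
pose q : {mpoly K[n]} := \prod_(i < n) 'X_i ^+ m (widen_ord (leqnSn n) i).
have -> : \prod_(i < n) 'X_(widen_ord (leqnSn n) i) ^+ m (widen_ord (leqnSn n) i)
        = mwiden q.
  rewrite rmorph_prod; apply: eq_bigr => i _.
  by rewrite rmorphXn /= mwidenX mnmwiden1.
by rewrite -mwidenZ.
Qed.

(** With [muni_last], this makes [muni] read [mwiden p * 'X_ord_max ^+ a] as the univariate monomial
    [p%:P * 'X ^+ a]. *)
Lemma muni_widen (K : comNzRingType) n (p : {mpoly K[n]}) :
  muni (mwiden p) = p%:P.
Proof.
elim/mpoly_ind_mulX: p => [p q IHp IHq|c p IHp||i p IHp].
- by rewrite !raddfD /= IHp IHq.
- by rewrite mwidenZ muniZ IHp -mul_mpolyC polyCM mul_polyC.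
- by rewrite !rmorph1.
rewrite !rmorphM /= IHp; congr (_ * _).
rewrite mwidenX mnmwiden1 muniE msuppX big_seq1 mcoeffX eqxx scale1r.
rewrite mnm1E -val_eqE /= ltn_eqF // expr0.
rewrite alg_polyC; congr (polyC 'X_[_]).
by apply/mnmP=> j; rewrite mnmE !mnm1E.
Qed.

Lemma muni_last (K : comNzRingType) n :
  muni 'X_ord_max = 'X :> {poly {mpoly K[n]}}.
Proof.
rewrite muniE msuppX big_seq1 mcoeffX eqxx scale1r mnm1E eqxx expr1.
rewrite [X in 'X_[X]](_ : _ = 0%MM) ?mpolyX0 ?scale1r //.
by apply/mnmP=> j; rewrite mnmE mnm1E mnm0E -val_eqE /= gtn_eqF.
Qed.

(** * Degenerate affine Hecke algebras *)

Section DahaTheory.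
Variables (K : fieldType) (n : nat) (H : daha K n).
Local Notation pol := (daha_pol H).
Local Notation x i := (daha_pol H 'X_i).
Local Notation pm := (daha_perm H).
Implicit Types (g h : H) (i j k : 'I_n).

Lemma daha_coordK h : daha_elt H (daha_coord h) = h.
Proof. exact/eqP/(xchooseP (daha_coord_subproof h)). Qed.

Lemma daha_eltK : cancel (daha_elt H) (@daha_coord K n H).
Proof. by move=> c; apply: (bij_inj (daha_basis H)); apply: daha_coordK. Qed.

Lemma daha_coordP h : h = \sum_w pol (daha_coord h w) * pm w.
Proof. by rewrite -{1}(daha_coordK h). Qed.

Lemma daha_coordE (c : 'S_n -> {mpoly K[n]}) w :
  daha_coord (\sum_v pol (c v) * pm v) w = c w.
Proof.
have -> : \sum_v pol (c v) * pm v = daha_elt H (finfun c).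
  by apply: eq_bigr => v _; rewrite ffunE.
by rewrite daha_eltK ffunE.
Qed.

Lemma daha_coordD g h w : daha_coord (g + h) w = daha_coord g w + daha_coord h w.
Proof.
rewrite [in LHS](daha_coordP g) [in LHS](daha_coordP h) -big_split /=.
by under eq_bigr => v _ do rewrite -mulrDl -raddfD; rewrite daha_coordE.
Qed.

Lemma daha_coord_polM p h w : daha_coord (pol p * h) w = p * daha_coord h w.
Proof.
rewrite [in LHS](daha_coordP h) mulr_sumr.
by under eq_bigr => v _ do rewrite mulrA -rmorphM /=; rewrite daha_coordE.
Qed.

Lemma daha_coord_Mperm h v w :
  daha_coord (h * pm v) w = daha_coord h (w * v^-1)%g.
Proof.
rewrite [in LHS](daha_coordP h) mulr_suml (reindex_inj (mulIg v^-1%g)) /=.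
under eq_bigr => u _ do rewrite -mulrA -daha_permM mulgKV.
by rewrite (daha_coordE (fun u => daha_coord h (u * v^-1)%g)).
Qed.

Lemma daha_coord1 w : daha_coord (1 : H) w = (w == 1%g)%:R.
Proof.
have -> : 1 = \sum_v pol (v == 1%g)%:R * pm v :> H.
  rewrite (bigD1 1%g) //= eqxx rmorph1 daha_perm1 mulr1 big1 ?addr0 // => v.
  by move=> /negPf->; rewrite raddf0 mul0r.
by rewrite (daha_coordE (fun v => (v == 1%g)%:R)).
Qed.

Lemma daha_coord_basis p v w :
  daha_coord (pol p * pm v : H) w = if w == v then p else 0.
Proof.
rewrite daha_coord_polM -[pm v]mul1r daha_coord_Mperm daha_coord1.
by rewrite -eq_mulgV1; case: eqP => _; rewrite ?mulr1 ?mulr0.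
Qed.

Lemma daha_perm_tpermK i j h : pm (tperm i j) * (pm (tperm i j) * h) = h.
Proof. by rewrite mulrA -daha_permM tperm2 daha_perm1 mul1r. Qed.

Lemma daha_adj_lo i j : j = i.+1 :> nat ->
  pm (tperm i j) * x i = x j * pm (tperm i j) - 1.
Proof. by move=> ij; rewrite daha_cross' // addrK. Qed.

(** The three cross relations in one formula, so that later inductions need no case analysis on the
    variable. *)
Lemma daha_adjX i j k : j = i.+1 :> nat ->
  pm (tperm i j) * x k =
  x (tperm i j k) * pm (tperm i j) + ((k == j)%:R - (k == i)%:R)%:A.
Proof.
move=> ij; have nji : (j == i) = false by rewrite -val_eqE /= ij gtn_eqF.
case: tpermP => [->|->|/eqP nki /eqP nkj].
- by rewrite daha_adj_lo // eqxx eq_sym nji sub0r scaleN1r.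
- by rewrite daha_cross // eqxx nji subr0 scale1r.
by rewrite daha_comm // (negPf nki) (negPf nkj) subr0 scale0r addr0.
Qed.

Lemma daha_polC p q : pol p * pol q = pol q * pol p.
Proof. by rewrite -!rmorphM mulrC. Qed.

Lemma daha_ind_basis (P : H -> Prop) :
  (forall g h, P g -> P h -> P (g + h)) ->
  (forall p w, P (pol p * pm w)) -> forall h, P h.
Proof.
move=> PD Pb h; rewrite (daha_coordP h); elim/big_ind: _ => //.
by have := Pb 0 1%g; rewrite raddf0 mul0r.
Qed.

Lemma daha_ind_mul (P : H -> Prop) :
  (forall g h, P g -> P h -> P (g + h)) -> (forall c h, P h -> P (c *: h)) ->
  P 1 -> (forall i h, P h -> P (x i * h)) ->
  (forall i j h, j = i.+1 :> nat -> P h -> P (pm (tperm i j) * h)) ->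
  forall h, P h.
Proof.
move=> PD PZ P1 PX Ps; apply: daha_ind_basis => // p w.
elim/mpoly_ind_mulX: p => [p q IHp IHq|c p IHp||i p IHp].
- by rewrite raddfD mulrDl; apply: PD.
- by rewrite linearZ -scalerAl; apply: PZ.
- rewrite rmorph1 mul1r; elim/perm_adj_ind: w => [|i j ij w IHw].
    by rewrite daha_perm1.
  by rewrite daha_permM; apply: Ps.
by rewrite rmorphM -mulrA; apply: PX.
Qed.

Lemma daha_sumX_adj i j : j = i.+1 :> nat ->
  pm (tperm i j) * \sum_k x k = (\sum_k x k) * pm (tperm i j).
Proof.
move=> ij; have nji : j != i by rewrite -val_eqE /= ij gtn_eqF.
rewrite (bigD1 i) //= (bigD1 j) //= addrA.
rewrite mulrDr mulrDl mulr_sumr mulr_suml; congr (_ + _).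
  rewrite mulrDr mulrDl daha_adj_lo // daha_cross // addrC -addrA.
  by rewrite [1 + _]addrC subrK.
by apply: eq_bigr => k /andP[nki nkj]; apply: daha_comm.
Qed.

(** An adjacent transposition swaps two summands, and the two correction terms +1 and -1 cancel. *)
Lemma daha_sumXC h : h * \sum_k x k = (\sum_k x k) * h.
Proof.
elim/daha_ind_mul: h => [g h Cg Ch|c h Ch||i h Ch|i j h ij Ch].
- by rewrite mulrDl mulrDr Cg Ch.
- by rewrite -scalerAl -scalerAr Ch.
- by rewrite mul1r mulr1.
- by rewrite -mulrA Ch !mulrA -raddf_sum daha_polC.
by rewrite -mulrA Ch !mulrA daha_sumX_adj.
Qed.

End DahaTheory.

Section DahaStab.
Variables (K : fieldType) (n : nat) (H : daha K n.+1).
Local Notation x i := (daha_pol H 'X_i).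
Local Notation pm := (daha_perm H).

(* For an inner letter [l] the claim fails: lifting an adjacent transposition *)
(* around [l] gives a non-adjacent one.                                       *)
Lemma daha_stabX (l : 'I_n.+1) (w : 'S_n.+1) : (l == ord0) || (l == ord_max) -> w l = l ->
  pm w * x l = x l * pm w.
Proof.
move=> l_end /perm_fix_lift[u ->]; elim/perm_adj_ind: u => [|i j ij u IHu].
  by rewrite lift_perm1 daha_perm1 mul1r mulr1.
rewrite -(lift_permM _ l) daha_permM -mulrA IHu !mulrA lift_perm_tperm.
rewrite daha_comm ?neq_lift //; case/orP: l_end => /eqP ->.
  by rewrite !lift0 ij.
by rewrite !lift_max.
Qed.

End DahaStab.

(** * The inclusion of h_n in h_{n+1} and left h_n-linear maps *)

Lemma mwiden_var (K : comNzRingType) n (i : 'I_n) :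
  mwiden 'X_i = 'X_(lift ord_max i) :> {mpoly K[n.+1]}.
Proof.
rewrite mwidenX mnmwiden1; congr 'X_[U_(_)].
exact/val_inj/esym/lift_max.
Qed.

Lemma exists_coset_part n (w : 'S_n.+1) :
  exists u, w == (lift_perm ord_max ord_max u * tperm ord_max (w ord_max))%g.
Proof. by have [u /eqP] := perm_coset w; exists u. Qed.

(* [w] is the product of the lift of [coset_part w], a permutation of the     *)
(* first [n] letters, and of the coset representative [tperm ord_max (w max)] *)
Definition coset_part n (w : 'S_n.+1) : 'S_n := xchoose (exists_coset_part w).

Lemma coset_partP n (w : 'S_n.+1) :
  w = (lift_perm ord_max ord_max (coset_part w) * tperm ord_max (w ord_max))%g.
Proof. exact/eqP/(xchooseP (exists_coset_part w)). Qed.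

Lemma coset_part_lift n (u : 'S_n) (w : 'S_n.+1) :
  coset_part (lift_perm ord_max ord_max u * w)%g = (u * coset_part w)%g.
Proof.
have lift_inj_perm : injective (@lift_perm n ord_max ord_max).
  move=> v1 v2 /permP ev; apply/permP=> i; apply: (@lift_inj _ ord_max).
  by rewrite -!(lift_perm_lift ord_max) ev.
apply: lift_inj_perm; apply: (mulIg (tperm ord_max (w ord_max))).
rewrite -(lift_permM _ ord_max) -mulgA -coset_partP.
rewrite [RHS]coset_partP; congr (_ * tperm _ _)%g.
by rewrite permM lift_perm_id.
Qed.

Lemma coset_part_tperm n (k : 'I_n.+1) : coset_part (tperm ord_max k) = 1%g.
Proof.
have := coset_partP (tperm ord_max k).
rewrite tpermL -{1}[tperm _ _]mul1g => /mulIg/permP e1; apply/permP=> i.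
apply: (@lift_inj _ ord_max); rewrite perm1.
by rewrite -(lift_perm_lift ord_max) -e1 perm1.
Qed.

Section Inclusion.
Variables (K : fieldType) (n : nat) (H : daha K n) (H' : daha K n.+1).
Local Notation pol := (daha_pol H).
Local Notation pm := (daha_perm H).
Local Notation pol' := (daha_pol H').
Local Notation pm' := (daha_perm H').
Local Notation lft u := (lift_perm ord_max ord_max u).
Local Notation T := (daha_pol H' 'X_ord_max).
Local Notation incl := (daha_incl H').
Implicit Types (g h : H) (i j k : 'I_n).

Lemma daha_incl_is_zmod : zmod_morphism (@daha_incl K n H H').
Proof.
move=> g h; rewrite /daha_incl -sumrB; apply: eq_bigr => w _.
have -> : daha_coord (g - h) w = daha_coord g w - daha_coord h w.
  by apply: (addIr (daha_coord h w)); rewrite -daha_coordD !subrK.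
by rewrite !raddfB mulrBl.
Qed.

HB.instance Definition _ :=
  GRing.isZmodMorphism.Build H H' (@daha_incl K n H H') daha_incl_is_zmod.

Lemma daha_incl_polM p h : incl (pol p * h) = pol' (mwiden p) * incl h.
Proof.
rewrite /daha_incl mulr_sumr; apply: eq_bigr => w _.
by rewrite daha_coord_polM !rmorphM mulrA.
Qed.

Lemma daha_incl_Mperm h u : incl (h * pm u) = incl h * pm' (lft u).
Proof.
rewrite /daha_incl mulr_suml (reindex_inj (mulIg u)) /=; apply: eq_bigr => w _.
by rewrite daha_coord_Mperm mulgK -mulrA -daha_permM lift_permM.
Qed.

Lemma daha_incl1 : incl (1 : H) = 1.
Proof.
rewrite /daha_incl (bigD1 1%g) //= daha_coord1 eqxx !rmorph1 mul1r.
rewrite lift_perm1 daha_perm1 big1 ?addr0 // => w /negPf nw1.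
by rewrite daha_coord1 nw1 !raddf0 mul0r.
Qed.

Lemma daha_inclZ c h : incl (c *: h) = c *: incl h.
Proof.
have -> : c *: h = pol (c *: 1) * h by rewrite linearZ rmorph1 -scalerAl mul1r.
rewrite daha_incl_polM mwidenZ [mwiden 1]rmorph1.
by rewrite linearZ rmorph1 -scalerAl mul1r.
Qed.

Lemma daha_incl_X k h : incl (pol 'X_k * h) = pol' 'X_(lift ord_max k) * incl h.
Proof. by rewrite daha_incl_polM mwiden_var. Qed.

(** The one nontrivial case of multiplicativity. Lifting around the last letter preserves adjacency,
    so [daha_adjX] moves the transposition past each variable with the same corrections in both
    algebras. *)
Lemma daha_incl_adj i j h : j = i.+1 :> nat ->
  incl (pm (tperm i j) * h) = pm' (lft (tperm i j)) * incl h.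
Proof.
move=> ij; elim/daha_ind_basis: h => [g h IHg IHh|p w].
  by rewrite mulrDr !raddfD /= IHg IHh mulrDr.
rewrite mulrA !daha_incl_Mperm mulrA; congr (_ * _).
elim/mpoly_ind_mulX: p => [p q IHp IHq|c p IHp||k p IHp].
- by rewrite raddfD mulrDr !raddfD /= mulrDr IHp IHq.
- by rewrite linearZ -scalerAr !daha_inclZ IHp scalerAr.
- by rewrite rmorph1 mulr1 -[pm _]mul1r daha_incl_Mperm daha_incl1 mul1r mulr1.
rewrite !rmorphM mulrA daha_adjX // mulrDl -mulrA raddfD /= daha_incl_X IHp.
rewrite daha_incl_X [in RHS]mulrA lift_perm_tperm daha_adjX; last first.
  by rewrite !lift_max.
rewrite mulrDl -[in RHS]mulrA -(inj_tperm _ _ _ (@lift_inj _ ord_max)).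
rewrite !(inj_eq (@lift_inj _ ord_max)); congr (_ + _).
by rewrite -!scalerAl !mul1r daha_inclZ.
Qed.

Lemma daha_inclM g h : incl (g * h) = incl g * incl h.
Proof.
elim/daha_ind_mul: g => [g1 g2 IH1 IH2|c g IHg||i g IHg|i j g ij IHg].
- by rewrite mulrDl !raddfD /= mulrDl IH1 IH2.
- by rewrite -scalerAl !daha_inclZ IHg scalerAl.
- by rewrite daha_incl1 !mul1r.
- by rewrite -mulrA !daha_incl_X IHg mulrA.
by rewrite -mulrA !daha_incl_adj // IHg mulrA.
Qed.

HB.instance Definition _ := GRing.isMonoidMorphism.Build H H'
  (@daha_incl K n H H') (conj daha_incl1 daha_inclM).
HB.instance Definition _ := GRing.isScalable.Build K H H' *:%R
  (@daha_incl K n H H') daha_inclZ.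

Lemma daha_incl_pol p : incl (pol p) = pol' (mwiden p).
Proof. by rewrite -[pol p]mulr1 daha_incl_polM rmorph1 mulr1. Qed.

Lemma daha_incl_perm u : incl (pm u) = pm' (lft u).
Proof. by rewrite -[pm u]mul1r daha_incl_Mperm rmorph1 mul1r. Qed.

Lemma daha_incl_lastC h : T * incl h = incl h * T.
Proof.
elim/daha_ind_basis: h => [g h IHg IHh|p w].
  by rewrite raddfD /= mulrDr mulrDl IHg IHh.
rewrite rmorphM /= daha_incl_pol daha_incl_perm mulrA daha_polC -!mulrA.
by rewrite -daha_stabX ?eqxx ?orbT // lift_perm_id.
Qed.

Lemma daha_incl_lastXC h a : T ^+ a * incl h = incl h * T ^+ a.
Proof. by apply/commr_sym/commrX/commr_sym/daha_incl_lastC. Qed.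

Lemma daha_incl_ind (P : H' -> Prop) :
  (forall y z, P y -> P z -> P (y + z)) ->
  (forall p a w, P (incl (pol p) * T ^+ a * pm' w)) -> forall y, P y.
Proof.
move=> PD Pb; apply: daha_ind_basis => // p w.
elim/mpoly_ind_last: p => [p q Pp Pq|p a].
  by rewrite raddfD mulrDl; apply: PD.
by rewrite rmorphM rmorphXn /= -daha_incl_pol; apply: Pb.
Qed.

Section Functional.
Variable v : nat -> 'I_n.+1 -> H.
Implicit Types (q : {poly {mpoly K[n]}}) (w : 'S_n.+1).

Let ev (z : nat -> H) (q : {poly {mpoly K[n]}}) :=
  \sum_(a < size q) pol q`_a * z a.

Let evE N z q : (size q <= N)%N -> ev z q = \sum_(a < N) pol q`_a * z a.
Proof.
move=> le_qN; rewrite /ev (big_ord_widen _ (fun a => pol q`_a * z a) le_qN).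
rewrite big_mkcond; apply: eq_bigr => a _; case: ltnP => // le_qa.
by rewrite nth_default // raddf0 mul0r.
Qed.

Let evD z (p q : {poly {mpoly K[n]}}) : ev z (p + q) = ev z p + ev z q.
Proof.
have [sp sq] := (leq_maxl (size p) (size q), leq_maxr (size p) (size q)).
rewrite !(@evE (maxn (size p) (size q))) ?size_polyD // -big_split /=.
by apply: eq_bigr => a _; rewrite coefD raddfD mulrDl.
Qed.

Let evCX z c a : ev z (c%:P * 'X^a) = pol c * z a.
Proof.
rewrite (@evE a.+1); last first.
  by rewrite mul_polyC (leq_trans (size_scale_leq _ _)) // size_polyXn.
rewrite big_ord_recr /= coefCM coefXn eqxx mulr1 big1 ?add0r // => b _.
by rewrite coefCM coefXn ltn_eqF // mulr0 raddf0 mul0r.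
Qed.

(* The left [H]-linear map sending [T ^+ a * tperm max k] to [v a k]; by the  *)
(* basis theorem these elements are free over [H].                            *)
Definition daha_functional (y : H') : H :=
  \sum_w ev (fun a => pm (coset_part w) * v a (w ord_max))
            (muni (daha_coord y w)).

Lemma daha_functionalD y z :
  daha_functional (y + z) = daha_functional y + daha_functional z.
Proof.
rewrite -big_split /=; apply: eq_bigr => w _.
by rewrite daha_coordD raddfD evD.
Qed.

Lemma daha_functional_basis p a w :
  daha_functional (incl (pol p) * T ^+ a * pm' w) =
  pol p * (pm (coset_part w) * v a (w ord_max)).
Proof.
rewrite daha_incl_pol -rmorphXn -rmorphM /daha_functional (bigD1 w) //=.
rewrite big1 => [|u /negPf nuw]; last first.
  by rewrite daha_coord_basis nuw raddf0 /ev size_poly0 big_ord0.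
rewrite addr0 daha_coord_basis eqxx rmorphM rmorphXn /= muni_widen muni_last.
exact: evCX.
Qed.

(** The permutation part of [g] commutes with [T], hence can be absorbed into [w], where it changes
    only the coset part. *)
Lemma daha_functional_sum g a w :
  daha_functional (incl g * T ^+ a * pm' w) =
  g * (pm (coset_part w) * v a (w ord_max)).
Proof.
elim/daha_ind_basis: g => [g h IHg IHh|p u].
  by rewrite raddfD /= !mulrDl daha_functionalD IHg IHh.
rewrite rmorphM /= daha_incl_perm -daha_incl_perm -[_ * _ * T ^+ a]mulrA.
rewrite -daha_incl_lastXC mulrA daha_incl_perm -[LHS]/(daha_functional _).
rewrite -mulrA -daha_permM daha_functional_basis coset_part_lift permM.
by rewrite lift_perm_id daha_permM !mulrA.
Qed.

Lemma daha_functionalM g y : daha_functional (incl g * y) = g * daha_functional y.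
Proof.
elim/daha_incl_ind: y => [y z IHy IHz|p a w].
  by rewrite mulrDr !daha_functionalD mulrDr IHy IHz.
by rewrite !mulrA -rmorphM !daha_functional_sum !mulrA.
Qed.

Lemma daha_functional_rep a (k : 'I_n.+1) :
  daha_functional (T ^+ a * pm' (tperm ord_max k)) = v a k.
Proof.
rewrite -[T ^+ a]mul1r -(rmorph1 incl) daha_functional_sum.
by rewrite coset_part_tperm daha_perm1 !mul1r tpermL.
Qed.

End Functional.
End Inclusion.

(** * The conjugates of the cyclotomic relation *)

Section ConjugatedRelation.
Variables (K : fieldType) (n : nat) (H : daha K n.+1) (r : nat) (q : {poly K}).
Hypotheses (q_monic : q \is monic) (size_q : size q = r.+1).
Local Notation pol := (daha_pol H).
Local Notation x i := (daha_pol H 'X_i).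
Local Notation pm := (daha_perm H).
Implicit Types (y z : H) (i j k : 'I_n.+1) (w : 'S_n.+1).

(** The sum is the divided difference of the b-th power. Its top term in x_j, at [a = b.-1], is the
    source of - T^{r-1} s_n in F. *)
Lemma daha_adj_exp i j b : j = i.+1 :> nat ->
  pm (tperm i j) * x i ^+ b =
  x j ^+ b * pm (tperm i j) - \sum_(a < b) x j ^+ a * x i ^+ (b.-1 - a).
Proof.
move=> ij; elim: b => [|b IHb]; first by rewrite big_ord0 subr0 mulr1 mul1r.
rewrite exprS mulrA daha_adj_lo // mulrBl mul1r -mulrA IHb mulrBr mulrA -exprS.
rewrite big_ord_recl expr0 mul1r subn0 [in RHS]opprD addrA addrAC; congr (_ - _).
congr (_ - _); rewrite mulr_sumr; apply: eq_bigr => a _.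
by rewrite mulrA -exprS /= /bump /= -subn1 -subnDA.
Qed.

Definition daha_cyc i : H := horner_alg (x i) q.

Lemma daha_cycE i : daha_cyc i = x i ^+ r + \sum_(b < r) q`_b *: x i ^+ b.
Proof.
rewrite /daha_cyc -[q in LHS]coefK poly_def size_q linear_sum /=.
rewrite big_ord_recr /= addrC; congr (_ + _).
  rewrite linearZ rmorphXn /= horner_algX mulr_algl.
  by move/monicP: q_monic; rewrite lead_coefE size_q /= => ->; rewrite scale1r.
by apply: eq_bigr => b _; rewrite linearZ rmorphXn /= horner_algX mulr_algl.
Qed.

Lemma daha_cyc_comm i y : y * x i = x i * y -> y * daha_cyc i = daha_cyc i * y.
Proof.
move=> yx; have yXn b : y * x i ^+ b = x i ^+ b * y.
  by apply/commrX.
rewrite daha_cycE mulrDr mulrDl yXn mulr_sumr mulr_suml; congr (_ + _).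
by apply: eq_bigr => b _; rewrite -scalerAr yXn scalerAl.
Qed.

Lemma daha_cyc_stab w : w ord0 = ord0 ->
  pm w * daha_cyc ord0 = daha_cyc ord0 * pm w.
Proof. by move=> w0; apply/daha_cyc_comm/daha_stabX. Qed.

Lemma daha_cycX i j : x j * daha_cyc i = daha_cyc i * x j.
Proof. by apply/daha_cyc_comm/daha_polC. Qed.

(** Scalar multiples of monomials in the variables before x_i; sums are left to [lower]. *)
Inductive below i : {mpoly K[n.+1]} -> Prop :=
| Below1 : below i 1
| BelowZ c p : below i p -> below i (c *: p)
| BelowX j p : (j < i)%N -> below i p -> below i ('X_j * p).

Lemma below_trans i j p : (i <= j)%N -> below i p -> below j p.
Proof.
move=> le_ij; elim=> [|c p' _ IHp|k p' lt_ki _ IHp].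
- exact: Below1.
- exact: BelowZ.
by apply: BelowX => //; apply: leq_trans le_ij.
Qed.

Lemma below_exp i j p b : (i < j)%N -> below j p -> below j ('X_i ^+ b * p).
Proof.
move=> lt_ij Bp; elim: b => [|b IHb]; first by rewrite mul1r.
by rewrite exprS -mulrA; apply: BelowX.
Qed.

Lemma below_adjC i j p : j = i.+1 :> nat -> below i p ->
  pm (tperm i j) * pol p = pol p * pm (tperm i j).
Proof.
move=> ij; elim=> [|c p' _ IHp|k p' lt_ki _ IHp].
- by rewrite rmorph1 mul1r mulr1.
- by rewrite linearZ -scalerAl -scalerAr IHp.
rewrite rmorphM /= mulrA daha_comm -?mulrA ?IHp ?mulrA //.
  by rewrite -val_eqE ltn_eqF.
by rewrite -val_eqE /= ij ltn_eqF // ltnW.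
Qed.

Lemma below_max_widen p : below ord_max p -> exists p', p = mwiden p'.
Proof.
elim=> [|c p' _ [p'' ->]|k p' lt_ki _ [p'' ->]].
- by exists 1; rewrite rmorph1.
- by exists (c *: p''); rewrite mwidenZ.
case: (unliftP ord_max k) lt_ki => [k'|] ->; last by rewrite ltnn.
by exists ('X_k' * p''); rewrite rmorphM /= mwiden_var.
Qed.

(** Remainder terms of the i-th conjugate of f, written with x_i to the right of the earlier
    variables. [Q] restricts which powers of x_i go with which permutations. *)
Inductive lower i (Q : nat -> 'S_n.+1 -> Prop) : H -> Prop :=
| Lower0 : lower i Q 0
| LowerD y z : lower i Q y -> lower i Q z -> lower i Q (y + z)
| LowerX p b w : below i p -> Q b w -> (forall j, (i < j)%N -> w j = j) ->
    lower i Q (pol p * x i ^+ b * pm w).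

Definition deg_lt (b : nat) (w : 'S_n.+1) : Prop := (b < r)%N.

(** In degree r - 1 the coset of [tperm i j] is excluded, so remainder terms cannot disturb the
    coefficient of x_j^{r-1} [tperm i j]. *)
Definition deg_lt_strict i j (b : nat) (w : 'S_n.+1) : Prop :=
  (b < r)%N /\ (b.+1 = r -> w j <> i).

Lemma lower_sub i (Q Q' : nat -> 'S_n.+1 -> Prop) y :
  (forall b w, Q b w -> Q' b w) -> lower i Q y -> lower i Q' y.
Proof.
move=> QQ'; elim=> [|y' z _ Ly _ Lz|p b w Bp Qb wi]; [exact: Lower0|exact: LowerD|].
by apply: LowerX => //; apply: QQ'.
Qed.

Lemma lower_sum I (s : seq I) i Q (F : I -> H) :
  (forall a, lower i Q (F a)) -> lower i Q (\sum_(a <- s) F a).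
Proof. by move=> LF; apply: big_ind => //; [apply: Lower0 | apply: LowerD]. Qed.

Lemma lowerZ i Q c y : lower i Q y -> lower i Q (c *: y).
Proof.
elim=> [|y' z _ Ly _ Lz|p b w Bp Qb wi].
- by rewrite scaler0; apply: Lower0.
- by rewrite scalerDr; apply: LowerD.
by rewrite !scalerAl -linearZ; apply: LowerX => //; apply: BelowZ.
Qed.

Lemma lower_conj_term i j p b w : j = i.+1 :> nat -> below i p -> (b <= r)%N ->
  (forall k, (i < k)%N -> w k = k) ->
  pm (tperm i j) * (pol p * x i ^+ b * pm w) * pm (tperm i j) =
  pol p * (x j ^+ b * pm (tperm i j * w * tperm i j)%g) -
  \sum_(a < b) pol p * (x j ^+ a * x i ^+ (b.-1 - a) * pm (w * tperm i j)%g).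
Proof.
move=> ij Bp le_br wi.
rewrite !mulrA below_adjC // -(mulrA (pol p)) daha_adj_exp // mulrBr !mulrBl.
congr (_ - _); first by rewrite !daha_permM !mulrA.
rewrite mulr_sumr !mulr_suml; apply: eq_bigr => a _.
by rewrite daha_permM !mulrA.
Qed.

Lemma lower_conj_corr i j p a e w Q : (i < j)%N -> below i p ->
  (forall k, (j < k)%N -> w k = k) -> Q a w ->
  lower j Q (pol p * (x j ^+ a * x i ^+ e * pm w)).
Proof.
move=> ij Bp wj Qa.
rewrite -!rmorphXn !mulrA -!rmorphM mulrC mulrA rmorphM rmorphXn /=.
by apply: LowerX => //; apply/below_exp/(below_trans (ltnW ij)).
Qed.

Lemma fix_above_conj i j w : j = i.+1 :> nat ->
  (forall k, (i < k)%N -> w k = k) ->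
  forall k, (j < k)%N -> (w * tperm i j)%g k = k /\
    (tperm i j * w * tperm i j)%g k = k.
Proof.
move=> ij wi k jk; have ik : (i < k)%N by move: jk; rewrite ij; apply: ltnW.
have tk : tperm i j k = k by rewrite tpermD // -val_eqE /= ltn_eqF.
by rewrite !permM tk wi // tk.
Qed.

(** Conjugating a term by the transposition gives a main term of the same degree, whose permutation
    cannot send j to i, and divided-difference terms of degree at most r - 2, for which the strict
    condition is vacuous. *)
Lemma lower_conj i j y : j = i.+1 :> nat -> lower i deg_lt y ->
  lower j (deg_lt_strict i j) (pm (tperm i j) * y * pm (tperm i j)).
Proof.
move=> ij; have lt_ij : (i < j)%N by rewrite ij.
elim=> [|y' z _ Ly _ Lz|p b w Bp br wi].
- by rewrite mulr0 mul0r; apply: Lower0.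
- by rewrite mulrDr mulrDl; apply: LowerD.
rewrite lower_conj_term ?(ltnW br) // -scaleN1r; apply: LowerD.
  rewrite mulrA; apply: LowerX => [||k jk]; last 1 first.
  - by case: (fix_above_conj ij wi jk).
  - exact: below_trans (ltnW lt_ij) Bp.
  (* If the conjugate of [w] sent j to i, then [w] would send i to j; but [w] already fixes j. *)
  split=> // _; rewrite !permM tpermR => /(canRL (tpermK i j)).
  by rewrite tpermL -[X in _ = X](wi j) // => /perm_inj eij; rewrite eij ltnn in lt_ij.
apply/lowerZ/lower_sum => a; apply: lower_conj_corr => // [k jk|].
  by case: (fix_above_conj ij wi jk).
split=> [|ar]; first by apply: ltn_trans br.
by have := leq_ltn_trans (ltn_ord a) br; rewrite ar ltnn.
Qed.

Definition conj_cyc i : H :=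
  pm (tperm ord0 i) * daha_cyc ord0 * pm (tperm ord0 i).

Lemma conj_cyc0 : conj_cyc ord0 = daha_cyc ord0.
Proof. by rewrite /conj_cyc tperm1 daha_perm1 mul1r mulr1. Qed.

(** For nonzero i, (0 j) is the conjugate of (0 i) by s = (i j), and s commutes with f because it
    fixes the letter 0. *)
Lemma conj_cycS i j : j = i.+1 :> nat ->
  conj_cyc j = pm (tperm i j) * conj_cyc i * pm (tperm i j).
Proof.
move=> ij; have [->|ni0] := eqVneq i ord0; first by rewrite conj_cyc0.
have nj0 : j != ord0 by rewrite -val_eqE /= ij.
have tJ : (tperm ord0 j = tperm i j * tperm ord0 i * tperm i j)%g.
  by rewrite -{1}(tpermV i j) -mulgA -/(conjg _ _) tpermJ tpermL tpermD.
have tM : (tperm i j * tperm ord0 i = tperm ord0 j * tperm i j)%g.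
  by rewrite tJ -mulgA tperm2 mulg1.
have tM' : (tperm ord0 i * tperm i j = tperm i j * tperm ord0 j)%g.
  by rewrite tJ !mulgA tperm2 mul1g.
rewrite /conj_cyc !mulrA -daha_permM tM -[RHS]mulrA -daha_permM tM'.
have sg : pm (tperm i j) * daha_cyc ord0 = daha_cyc ord0 * pm (tperm i j).
  by apply: daha_cyc_stab; rewrite tpermD.
by rewrite !daha_permM -!mulrA (mulrA (pm (tperm i j)) (daha_cyc _)) sg -mulrA daha_perm_tpermK.
Qed.

Hypothesis r_gt0 : (0 < r)%N.

(** Conjugating x_i^r yields x_j^r minus a divided difference times the transposition. Its summand
    of index r - 1 is split off as the distinguished term; everything else satisfies the strict
    condition. *)
Let expand_step i j E : j = i.+1 :> nat -> lower i deg_lt E ->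
  conj_cyc i = x i ^+ r + E ->
  exists2 E', lower j (deg_lt_strict i j) E' &
    conj_cyc j = x j ^+ r - x j ^+ r.-1 * pm (tperm i j) + E'.
Proof.
move=> ij LE Fi; have lt_ij : (i < j)%N by rewrite ij.
have := @lower_conj_term i j 1 r 1%g ij (Below1 i) (leqnn r).
rewrite !rmorph1 daha_perm1 mulr1 !mul1r !mulg1 tperm2 daha_perm1 mulr1.
rewrite mul1g => Fx.
rewrite (conj_cycS ij) Fi mulrDr mulrDl {}Fx; last by move=> k _; rewrite perm1.
have sum_pred (G : nat -> H) : \sum_(a < r) G a = \sum_(a < r.-1) G a + G r.-1.
  by rewrite -[in LHS](prednK r_gt0) big_ord_recr.
rewrite (sum_pred (fun a => 1 * (x j ^+ a * x i ^+ (r.-1 - a) * pm (tperm i j)))).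
rewrite subnn expr0 mulr1 mul1r.
exists (- (\sum_(a < r.-1) 1 * (x j ^+ a * x i ^+ (r.-1 - a) * pm (tperm i j)))
        + pm (tperm i j) * E * pm (tperm i j)); last first.
  by rewrite opprD !addrA (addrAC (x j ^+ r)).
apply: LowerD; last exact: lower_conj.
rewrite -scaleN1r; apply/lowerZ/lower_sum => a.
rewrite -(rmorph1 pol); apply: lower_conj_corr; first exact: lt_ij.
- exact: Below1.
- by move=> k jk; rewrite tpermD // -val_eqE ltn_eqF // (ltn_trans lt_ij).
have ar : (a.+1 < r)%N by rewrite -ltn_predRL.
by split=> [|ar']; [apply: ltnW | move: ar; rewrite ar' ltnn].
Qed.

Lemma conj_cyc_lower i : exists2 E, lower i deg_lt E & conj_cyc i = x i ^+ r + E.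
Proof.
case: i => i lti; elim: i lti => [|i IHi] lti.
  have -> : Ordinal lti = ord0 by apply: val_inj.
  rewrite conj_cyc0 daha_cycE; exists (\sum_(b < r) q`_b *: x ord0 ^+ b) => //.
  apply: lower_sum => b; apply: lowerZ.
  have -> : x ord0 ^+ b = pol 1 * x ord0 ^+ b * pm 1%g.
    by rewrite rmorph1 daha_perm1 mul1r mulr1.
  by apply: LowerX => [||k _]; [apply: Below1 | apply: ltn_ord | rewrite perm1].
have [E LE FE] := IHi (ltnW lti).
have [E' LE' ->] := @expand_step (Ordinal (ltnW lti)) (Ordinal lti) _ erefl LE FE.
exists (- (x (Ordinal lti) ^+ r.-1 * pm (tperm (Ordinal (ltnW lti)) (Ordinal lti))) + E').
  apply: LowerD; last by apply: lower_sub LE' => b w [].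
  rewrite -scaleN1r -[x _ ^+ _]mul1r -(rmorph1 pol); apply/lowerZ/LowerX.
  - exact: Below1.
  - by rewrite /deg_lt ltn_predL.
  move=> k ltk; rewrite tpermD // -val_eqE /= ltn_eqF //.
  by apply: leq_trans ltk => /=.
by rewrite addrA.
Qed.

Lemma conj_cyc_lowerS i j : j = i.+1 :> nat ->
  exists2 E, lower j (deg_lt_strict i j) E &
    conj_cyc j = x j ^+ r - x j ^+ r.-1 * pm (tperm i j) + E.
Proof.
by move=> ij; have [E LE /(expand_step ij LE)] := conj_cyc_lower i.
Qed.

(** For i = 1 this is a direct computation. Afterwards one conjugates by an adjacent transposition
    fixing the letter 0, which commutes with both x_0 and f. *)
Lemma conj_cycX0 i : i != ord0 ->
  conj_cyc i * x ord0 = x ord0 * conj_cyc i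
    + daha_cyc ord0 * pm (tperm ord0 i) - pm (tperm ord0 i) * daha_cyc ord0.
Proof.
case: i => i lti; rewrite -val_eqE /=; elim: i lti => // -[|i] IHi lti _.
  set j := Ordinal lti; have j1 : j = (@ord0 n).+1 :> nat by [].
  set s := pm (tperm ord0 j).
  rewrite /conj_cyc -/s -(mulrA (s * _)) daha_adj_lo // mulrBr mulr1 -/s.
  rewrite (mulrA (s * _)) -(mulrA s) -daha_cycX (mulrA s) daha_cross // -/s.
  by rewrite !mulrDl mul1r !mulrA.
have lti' := ltnW lti; have /= := IHi lti' isT.
set i' := Ordinal lti'; set j := Ordinal lti => IH.
have ij : j = i'.+1 :> nat by [].
have sX0 : pm (tperm i' j) * x ord0 = x ord0 * pm (tperm i' j).
  by apply: daha_comm.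
have sg : pm (tperm i' j) * daha_cyc ord0 = daha_cyc ord0 * pm (tperm i' j).
  by apply: daha_cyc_stab; rewrite tpermD.
have st : pm (tperm ord0 j) = pm (tperm i' j) * pm (tperm ord0 i') * pm (tperm i' j).
  rewrite -!daha_permM; congr daha_perm.
  by rewrite -{1}(tpermV i' j) -mulgA -/(conjg _ _) tpermJ tpermL tpermD.
rewrite (conj_cycS ij) st; move: (conj_cyc i') IH => F IH.
rewrite -!mulrA sX0 (mulrA F) IH.
by rewrite mulrBl mulrDl mulrBr mulrDr !mulrA sX0 sg -!mulrA sg.
Qed.

(** Conjugation by (0 i) turns a permutation fixing i into one fixing 0, and those commute with
    f. *)
Lemma conj_cyc_stab i w : w i = i -> i != ord0 ->
  pm w * conj_cyc i = conj_cyc i * pm w.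
Proof.
move=> wi i0; rewrite /conj_cyc !mulrA -daha_permM.
have -> : (w * tperm ord0 i = tperm ord0 i * w ^ tperm ord0 i)%g.
  by rewrite conjgC.
rewrite daha_permM -(mulrA (pm _)) daha_cyc_stab; last first.
  by have := permJ w (tperm ord0 i) i; rewrite wi tpermR.
by rewrite -!mulrA -!daha_permM /conjg tpermV -!mulgA tperm2 mulg1.
Qed.

End ConjugatedRelation.

(** * The functional c *)

(** The value at [a] of the iterates of [F] is stable from step [a.+1] on. *)
Lemma strong_recurrence T (t0 : T) (F : (nat -> T) -> nat -> T) :
  (forall V V' a, (forall b, (b < a)%N -> V b = V' b) -> F V a = F V' a) ->
  exists V, forall a, V a = F V a.
Proof.
move=> Floc; pose W N := iter N F (fun=> t0).
have WE a : forall N, (a < N)%N -> W N a = W a.+1 a.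
  elim/ltn_ind: a => a IHa [|N] // le_aN; apply: Floc => b lt_ba.
  exact: etrans (IHa b lt_ba N (leq_trans lt_ba le_aN)) (esym (IHa b lt_ba a lt_ba)).
exists (fun a => W a.+1 a) => a; rewrite {1}/W /=.
by apply: Floc => b lt_ba; apply: WE.
Qed.

Section CyclotomicFunctional.
Variables (K : fieldType) (m : nat) (H : daha K m.+1) (H' : daha K m.+2).
Variables (r : nat) (q : {poly K}).
Hypotheses (q_monic : q \is monic) (size_q : size q = r.+1) (r_gt0 : (0 < r)%N).
Local Notation x i := (daha_pol H' 'X_i).
Local Notation pm := (daha_perm H').
Local Notation incl := (daha_incl H').
Local Notation T := (daha_pol H' 'X_ord_max).
Local Notation F := (conj_cyc H' q ord_max).
Implicit Types (y z b : H') (i j k : 'I_m.+2) (w : 'S_m.+2).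

(** The last but one letter: [tperm i0 ord_max] is the generator s_n. *)
Let i0 : 'I_m.+2 := lift ord_max ord_max.

Let lower_termE (v : nat -> 'I_m.+2 -> H) p (d a : nat) u w :
  daha_functional v
    (T ^+ d * (daha_pol H' (mwiden p) * T ^+ a * pm u) * pm w) =
  daha_pol H p *
    (daha_perm H (coset_part (u * w)%g) * v (d + a)%N ((u * w)%g ord_max)).
Proof.
rewrite -(@daha_incl_pol _ _ H) !mulrA daha_incl_lastXC -(mulrA (incl _)) -exprD.
by rewrite -mulrA -daha_permM daha_functional_sum mulrA.
Qed.

(** The argument has degree less than [d + r] in [T]. This is what makes the recursion for [v] well
    founded. *)
Lemma daha_functional_local (v v' : nat -> 'I_m.+2 -> H) d y w :
  lower ord_max (deg_lt r) y ->
  (forall a, (a < d + r)%N -> v a = v' a) ->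
  daha_functional v (T ^+ d * y * pm w) =
  daha_functional v' (T ^+ d * y * pm w).
Proof.
move=> Ly vv'; elim: Ly => [|y' z _ IHy _ IHz|p a u Bp ar _].
- have f0 v0 : daha_functional v0 (T ^+ d * 0 * pm w) = 0.
    apply: (addrI (daha_functional v0 (T ^+ d * 0 * pm w))).
    by rewrite -daha_functionalD addr0 mulr0 mul0r addr0.
  by rewrite !f0.
- by rewrite mulrDr mulrDl !daha_functionalD IHy IHz.
have [p' ->] := below_max_widen Bp.
by rewrite !lower_termE vv' // ltn_add2l.
Qed.

Let functional0 (v : nat -> 'I_m.+2 -> H) : daha_functional v (0 : H') = 0.
Proof.
apply: (addrI (daha_functional v (0 : H'))).
by rewrite -daha_functionalD !addr0.
Qed.

Let tM w : exists u, pm w = incl (daha_perm H u) * pm (tperm ord_max (w ord_max)).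
Proof.
by have [u uP] := perm_coset w; exists u; rewrite daha_incl_perm -daha_permM -uP.
Qed.

Let lastXC_perm a u :
  T ^+ a * F * incl (daha_perm H u) = incl (daha_perm H u) * (T ^+ a * F).
Proof.
rewrite daha_incl_perm -mulrA -(conj_cyc_stab _ q_monic size_q) ?lift_perm_id //.
by rewrite !mulrA -(@daha_incl_perm _ _ H) daha_incl_lastXC.
Qed.

(* [v a k], the value of [c] at [T ^+ a * tperm ord_max k], is prescribed for *)
(* [a < r] and then determined by [c (T ^+ a * F * _) = 0]. The coefficient   *)
(* [-1] of [T ^+ r.-1 * tperm i0 ord_max] in [F] gives [c (T ^+ r) = 1].      *)
Lemma exists_cyclotomic_functional : exists c : H' -> H,
  [/\ forall y z, c (y + z) = c y + c z,
      forall h y, c (incl h * y) = h * c y,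
      forall a, (a < r)%N -> c (T ^+ a) = 0,
      c (T ^+ r) = 1 &
      forall a w, c (T ^+ a * F * pm w) = 0].
Proof.
have max_i0 : @ord_max m.+1 = i0.+1 :> nat by rewrite lift_max.
have [E' LE' FE'] := conj_cyc_lowerS H' q_monic size_q r_gt0 max_i0.
pose E := - (T ^+ r.-1 * pm (tperm i0 ord_max)) + E'.
have FE : F = T ^+ r + E by rewrite /E addrA.
have LE : lower ord_max (deg_lt r) E.
  apply: LowerD; last by apply: lower_sub LE' => b w [].
  rewrite -scaleN1r -[T ^+ _]mul1r -(rmorph1 (daha_pol H')); apply/lowerZ/LowerX.
  - exact: Below1.
  - by rewrite /deg_lt ltn_predL.
  by move=> k; rewrite ltnNge -ltnS ltn_ord.
pose G (v : nat -> 'I_m.+2 -> H) a k : H :=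
  if (a < r)%N then ((a.+1 == r) && (k == i0))%:R
  else - daha_functional v (T ^+ (a - r) * E * pm (tperm ord_max k)).
have [v vE] : exists v, forall a, v a = G v a.
  apply: (strong_recurrence (fun=> 0)) => v v' a vv'; apply/funext => k.
  rewrite /G; case: ltnP => // le_ra; congr (- _).
  by apply: daha_functional_local => // b; rewrite subnK //; apply: vv'.
pose c := @daha_functional _ _ _ H' v.
have cD y z : c (y + z) = c y + c z by apply: daha_functionalD.
have cM h y : c (incl h * y) = h * c y by apply: daha_functionalM.
have cN y : c (- y) = - c y.
  by apply: (addrI (c y)); rewrite -cD !subrr; apply: functional0.
have cF0 a k : c (T ^+ a * F * pm (tperm ord_max k)) = 0.
  rewrite FE mulrDr mulrDl cD -exprD /c daha_functional_rep vE /G.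
  by rewrite ltnNge leq_addl addnK addNr.
have cT a k : (a < r)%N ->
    c (T ^+ a * pm (tperm ord_max k)) = ((a.+1 == r) && (k == i0))%:R.
  by move=> ar; rewrite /c daha_functional_rep vE /G ar.
have pm1 : pm (tperm ord_max ord_max) = 1 by rewrite tperm1 daha_perm1.
have max_neq : (@ord_max m.+1 == i0) = false.
  by apply: negPf; exact: neq_lift.
exists c; split=> // [a ar||a w].
- by rewrite -[T ^+ a]mulr1 -pm1 cT // max_neq andbF.
(* In degrees below r only T^{r-1} s_n has a nonzero value, and the strict condition keeps its coset
   out of [E']. *)
- have cE' : c E' = 0.
    elim: LE' => [|y z _ cy _ cz|p a u Bp [ar ui0] _]; first exact: functional0.
      by rewrite cD cy cz addr0.
    have [p' ->] := below_max_widen Bp.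
    rewrite /c -(@daha_incl_pol _ _ H) daha_functional_sum vE /G ar.
    have [/ui0/eqP/negPf->|] := eqVneq; first by rewrite !mulr0.
    by rewrite !mulr0.
  (* c(F) = 0 now reads c(T^r) = c(T^{r-1} s_n), and the right side is 1 by choice. *)
  have := cF0 0%N ord_max; rewrite pm1 mulr1 mul1r FE' !cD cN cE' addr0.
  rewrite tpermC cT ?prednK ?ltn_predL // !eqxx => /eqP.
  by rewrite subr_eq0 => /eqP.
have [u ->] := tM w.
by rewrite mulrA lastXC_perm -mulrA cM cF0 mulr0.
Qed.

End CyclotomicFunctional.

(** * The functional c and the cyclotomic ideal *)

Section CyclotomicIdeal.
Variables (K : fieldType) (m : nat) (H : daha K m.+1) (H' : daha K m.+2).
Variables (r : nat) (q : {poly K}).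
Hypotheses (q_monic : q \is monic) (size_q : size q = r.+1).
Local Notation x i := (daha_pol H' 'X_i).
Local Notation pm := (daha_perm H').
Local Notation incl := (daha_incl H').
Local Notation T := (daha_pol H' 'X_ord_max).
Local Notation t := (pm (tperm ord0 ord_max)).
Implicit Types (y z b : H') (i j k : 'I_m.+2) (w : 'S_m.+2).
Variable G : H -> Prop.
Local Notation I := (ideal_gen G).
Hypothesis cyc_in_I : daha_cyc H q ord0 \in I.

(* [F] is kept abstract so that [mulrA] does not reassociate inside [conj_cyc] *)
Variables (F : H') (c : H' -> H).
Hypotheses (F_def : F = conj_cyc H' q ord_max)
  (cD : forall y z, c (y + z) = c y + c z)
  (cM : forall h y, c (incl h * y) = h * c y)
  (cF : forall a w, c (T ^+ a * F * pm w) = 0).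

Lemma daha_incl_cyc : daha_cyc H' q ord0 = incl (daha_cyc H q ord0).
Proof.
have x0 : x ord0 = incl (daha_pol H 'X_ord0).
  rewrite daha_incl_pol mwiden_var; congr (daha_pol H' 'X_ _).
  by apply: val_inj; rewrite /= /bump.
rewrite !(daha_cycE _ q_monic size_q) raddfD raddf_sum /= rmorphXn /= -x0.
by congr (_ + _); apply: eq_bigr => a _; rewrite linearZ rmorphXn /= -x0.
Qed.

Let F_stab w : w ord_max = ord_max -> pm w * F = F * pm w.
Proof. by move=> wmax; rewrite F_def (conj_cyc_stab _ q_monic size_q). Qed.

Let t_cyc : t * daha_cyc H' q ord0 = F * t.
Proof.
by rewrite F_def /conj_cyc -!mulrA -daha_permM tperm2 daha_perm1 mulr1.
Qed.

Let F_X0 : F * x ord0 = x ord0 * F + daha_cyc H' q ord0 * t - F * t.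
Proof. by rewrite -t_cyc F_def (conj_cycX0 _ q_monic size_q). Qed.

Let c0 : c 0 = 0.
Proof. by apply: (addrI (c 0)); rewrite -cD !addr0. Qed.

Let cN y : c (- y) = - c y.
Proof. by apply: (addrI (c y)); rewrite -cD !subrr c0. Qed.

Let cZ l y : c (l *: y) = l%:A * c y.
Proof. by rewrite -cM linearZ rmorph1 /= mulr_algl. Qed.

Let cZ_I l y : c y \in I -> c (l *: y) \in I.
Proof. by move=> cyI; rewrite cZ; apply: ideal_genMl. Qed.

(** Quantifying over [a] and [w] makes this stable under left multiplication of [b] by the
    generators. *)
Let good b := forall a w, c (T ^+ a * F * pm w * b) \in I.

Let goodD b b' : good b -> good b' -> good (b + b').
Proof. by move=> gb gb' a w; rewrite mulrDr cD rpredD. Qed.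

Let goodZ l b : good b -> good (l *: b).
Proof. by move=> gb a w; rewrite -scalerAr cZ_I. Qed.

Let good_perm w b : good b -> good (pm w * b).
Proof. by move=> gb a w'; rewrite mulrA -(mulrA _ (pm w')) -daha_permM. Qed.

Let perm_max_incl w : w ord_max = ord_max -> exists u,
  pm w = incl (daha_perm H u).
Proof. by case/perm_fix_lift=> u ->; exists u; rewrite daha_incl_perm. Qed.

(** For x_0, [F_X0] leaves terms handled by [good b] or containing f on the left, which [cM]
    extracts into [I]. The later variables come from x_j = s x_i s + s, where s fixes the last
    letter and so commutes with T^a F. *)
Let good_conjX_lt i a b : good b -> i != ord_max -> c (T ^+ a * F * x i * b) \in I.
Proof.
have x_incl k : k != ord_max -> exists h : H, x k = incl h.
  case: (unliftP ord_max k) => [k'|] ->; last by rewrite eqxx.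
  by exists (daha_pol H 'X_k'); rewrite daha_incl_pol mwiden_var.
case: i => i lti; elim: i lti b => [|i IHi] lti b gb ni.
  have -> : Ordinal lti = ord0 by apply: val_inj.
  rewrite -(mulrA (T ^+ a)) F_X0 mulrBr mulrBl mulrDr mulrDl cD cN cD.
  apply: rpredB; last by rewrite !mulrA; apply: gb.
  have [h hE] : exists h : H, x ord0 = incl h by apply: x_incl.
  apply: rpredD.
    rewrite hE !mulrA daha_incl_lastXC -!mulrA cM ideal_genMl // !mulrA.
    by have := gb a 1%g; rewrite daha_perm1 mulr1.
  by rewrite daha_incl_cyc !mulrA daha_incl_lastXC -!mulrA cM; apply: ideal_genMr.
have lti' := ltnW lti; set j := Ordinal lti; pose i' := Ordinal lti'.
have ij : j = i'.+1 :> nat by [].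
set s := pm (tperm i' j).
have ltim : (i < m.+1)%N by [].
have sfix : tperm i' j ord_max = ord_max.
  by rewrite tpermD // -val_eqE /= ltn_eqF.
have TFs : T ^+ a * F * s = s * (T ^+ a * F).
  have [u sE] := perm_max_incl sfix.
  rewrite -mulrA -F_stab // -/s.
  by rewrite /s sE !mulrA daha_incl_lastXC.
have -> : x j = s * x i' * s + s.
  rewrite -[x j]mulr1 -daha_perm1 -(tperm2 i' j) daha_permM mulrA.
  by rewrite daha_cross' // mulrDl mul1r.
have s_I y : c y \in I -> c (s * y) \in I.
  by have [u sE] := perm_max_incl sfix; rewrite /s sE cM; apply: ideal_genMl.
rewrite mulrDr mulrDl cD; apply: rpredD.
  rewrite !mulrA TFs -!mulrA; apply: s_I; rewrite !mulrA -(mulrA _ s).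
  by apply: IHi; [apply: good_perm | rewrite -val_eqE /= ltn_eqF].
by have := gb a (tperm i' j).
Qed.

(** The last variable is the central sum minus the earlier variables; the central sum moves to the
    left of [F], where each x_k is either extracted by [cM] or raises the power of [T]. *)
Let good_conjX i a b : good b -> c (T ^+ a * F * x i * b) \in I.
Proof.
move=> gb; have [->|] := eqVneq i ord_max; last exact: good_conjX_lt.
have F_sum : F * T = (\sum_k x k) * F - \sum_(k | k != ord_max) F * x k.
  rewrite -daha_sumXC (bigD1 ord_max) //= mulrDr mulr_sumr.
  by rewrite addrK.
rewrite -(mulrA _ F) F_sum mulrBr mulrBl cD cN.
have c_sum (P : pred 'I_m.+2) (g : 'I_m.+2 -> H') :
    (forall k, P k -> c (T ^+ a * g k * b) \in I) ->
    c (T ^+ a * (\sum_(k | P k) g k) * b) \in I.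
  move=> gI; elim/big_rec: _ => [|k y Pk yI].
    by rewrite mulr0 mul0r c0 rpred0.
  by rewrite mulrDr mulrDl cD rpredD ?gI.
apply: rpredB; last first.
  by apply: c_sum => k nk; rewrite mulrA; apply: good_conjX_lt.
rewrite mulr_suml; apply: c_sum => k _.
have F_I d : c (T ^+ d * (F * b)) \in I.
  by have := gb d 1%g; rewrite daha_perm1 mulr1 mulrA.
case: (unliftP ord_max k) => [k'|] ->.
  have -> : x (lift ord_max k') = incl (daha_pol H 'X_k').
    by rewrite daha_incl_pol mwiden_var.
  by rewrite mulrA daha_incl_lastXC -!mulrA cM ideal_genMl.
by rewrite mulrA -exprSr -mulrA.
Qed.

Let goodX i b : good b -> good (x i * b).
Proof.
move=> gb a w; elim/perm_adj_ind_r: w i b gb => [|j k jk w IHw] i b gb.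
  by rewrite daha_perm1 mulr1 mulrA; apply: good_conjX.
have gb' := good_perm (tperm j k) gb.
rewrite -(mulrA (_ * F)); have -> : pm (w * tperm j k)%g * (x i * b) =
    pm w * (x (tperm j k i) * (pm (tperm j k) * b))
    + ((i == k)%:R - (i == j)%:R) *: (pm w * b).
  rewrite daha_permM -(mulrA (pm w)) (mulrA _ (x i)) daha_adjX //.
  by rewrite mulrDl mulrDr mulr_algl -scalerAr !mulrA.
rewrite mulrDr cD -scalerAr; apply: rpredD; last by rewrite cZ_I // mulrA.
by rewrite mulrA; apply: IHw.
Qed.

Let good_all b : good b.
Proof.
elim/daha_ind_mul: b => [b b' gb gb'|l b gb||i b gb|i j b ij gb].
- exact: goodD.
- exact: goodZ.
- by move=> a w; rewrite mulr1 cF rpred0.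
- exact: goodX.
exact: good_perm.
Qed.

(** Reduce [y] to T^a times a coset representative. The representative exchanging 0 and the last
    letter turns f into F, and [good_all] applies; every other one commutes with f, which then comes
    out of c as an element of [I]. *)
Lemma functional_cyc_ideal y z : c (y * daha_cyc H' q ord0 * z) \in I.
Proof.
elim/(@daha_incl_ind _ _ H): y => [y y' Iy Iy'|p a w].
  by rewrite !mulrDl cD rpredD.
rewrite -!mulrA cM; apply: ideal_genMl; rewrite !mulrA.
have [u ->] := perm_coset w; rewrite daha_permM mulrA -(@daha_incl_perm _ _ H).
rewrite daha_incl_lastXC -!mulrA cM; apply: ideal_genMl; rewrite !mulrA.
have [->|wn0] := eqVneq (w ord_max) ord0.
  rewrite tpermC -(mulrA (T ^+ a)) t_cyc mulrA.
  exact: good_all.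
rewrite -(mulrA (T ^+ a)) (daha_cyc_stab _ q_monic size_q); last by rewrite tpermD.
by rewrite daha_incl_cyc mulrA daha_incl_lastXC -!mulrA cM; apply: ideal_genMr.
Qed.

End CyclotomicIdeal.

(** * Composition series *)

Section Length.
Variables (R : pzRingType) (V : lmodType R) (K : closedFieldType) (d : nat).
Variables (kappa : K -> R) (phi : 'rV[K]_d -> V).
Hypotheses (phiD : forall u v, phi (u + v) = phi u + phi v)
  (phiZ : forall a v, phi (a *: v) = kappa a *: phi v)
  (phi_surj : forall x, exists v, x = phi v).
Implicit Types (U W X : {pred V}).

Let phi0 : phi 0 = 0.
Proof. by apply: (addrI (phi 0)); rewrite -phiD !addr0. Qed.

(** The preimage of a submodule is a subspace of row vectors; a matrix of maximal rank among those
    with rows in it spans it. *)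
Lemma submod_mx U : exists A : 'M[K]_d,
  submod_closed U -> forall v, (v <= A)%MS = (phi v \in U).
Proof.
have [smU|nU] := pselect (submod_closed U); last by exists 0.
pose inU m (A : 'M[K]_(m, d)) := forall v : 'rV_d, (v <= A)%MS -> phi v \in U.
pose has_rank k := `[< exists2 A : 'M[K]_d, inU _ A & \rank A = k >].
have rank0 : exists k, has_rank k.
  exists 0%N; apply/asboolP; exists 0; last exact: mxrank0.
  by move=> v; rewrite submx0 => /eqP->; rewrite phi0; case: smU.
have rank_le k : has_rank k -> (k <= d)%N.
  by case/asboolP=> A _ <-; apply: rank_leq_row.
case: (ex_maxnP rank0 rank_le) => k /asboolP[A AU rA] k_max.
exists A => _ v; apply/idP/idP => [/AU //|vU].
have sAv : (A <= A + v)%MS by apply: addsmxSl.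
have : (\rank (A + v)%MS <= \rank A)%N.
  rewrite rA; apply: k_max; apply/asboolP; exists (A + v)%MS => // w.
  case/sub_addsmxP=> -[u1 u2] /= ->.
  have [a ->] : exists a, u2 = a%:M :> 'M_1 by exists (u2 0 0); exact: mx11_scalar.
  have [_ Ulin] := smU; rewrite mul_scalar_mx addrC phiD phiZ.
  by apply: Ulin => //; apply: AU; apply: submxMl.
rewrite (geq_leqif (mxrank_leqif_sup sAv)).
exact: submx_trans (addsmxSr _ _).
Qed.

Let smx U := projT1 (cid (submod_mx U)).
Let smxP U : submod_closed U -> forall v, (v <= smx U)%MS = (phi v \in U).
Proof. by rewrite /smx; case: cid. Qed.

Lemma submod_rank_lt U W : submod_closed U -> submod_closed W ->
  {subset U <= W} -> ~ {subset W <= U} -> (\rank (smx U) < \rank (smx W))%N.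
Proof.
move=> smU smW sUW nWU; apply: rank_ltmx; rewrite /ltmx; apply/andP; split.
  by apply/row_subP => i; rewrite smxP //; apply: sUW; rewrite -smxP // row_sub.
apply/negP => sWU; apply: nWU => y; have [v ->] := phi_surj y.
by rewrite -!smxP // => vW; apply: submx_trans sWU.
Qed.

Definition factor_chain k U W := exists C : nat -> {pred V},
  [/\ forall i, (i <= k)%N -> submod_closed (C i), C 0%N = U, C k = W &
      forall i, (i < k)%N -> simple_factor (C i) (C i.+1)].

Lemma factor_chain_cat k l U W X :
  factor_chain k U W -> factor_chain l W X -> factor_chain (k + l) U X.
Proof.
move=> [C [smC C0 Ck simC]] [D [smD D0 Dl simD]].
pose B i := if (i <= k)%N then C i else D (i - k)%N.
have BD i : (k <= i)%N -> B i = D (i - k)%N.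
  rewrite leq_eqVlt /B => /orP[/eqP<-|]; first by rewrite leqnn subnn Ck D0.
  by rewrite ltnNge => /negPf->.
exists B; split=> [i ikl|||i ikl].
- have [ik|/ltnW ki] := leqP i k; first by rewrite /B ik; apply: smC.
  by rewrite BD //; apply: smD; rewrite leq_subLR.
- by rewrite /B.
- by rewrite BD ?leq_addr // addKn.
have [ik|ki] := ltnP i k; first by rewrite /B ik (ltnW ik); apply: simC.
rewrite !BD ?leqW // subSn //; apply: simD.
by rewrite ltn_subLR.
Qed.

(** Induction on the dimension gap of the preimages: a non-simple step has a strictly intermediate
    submodule, which splits the gap. *)
Lemma submod_refine U W : submod_closed U -> submod_closed W ->
  {subset U <= W} ->
  exists2 k, factor_chain k U W & (~ {subset W <= U} -> (0 < k)%N).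
Proof.
move En: (\rank (smx W) - \rank (smx U))%N => N.
elim/ltn_ind: N U W En => N IHN U W En smU smW sUW.
have [sWU|nWU] := pselect {subset W <= U}.
  have eUW : U = W.
    by apply/funext => y; apply/idP/idP; [apply: sUW | apply: sWU].
  by exists 0%N => //; exists (fun=> U); split.
have [simp|nsimp] := pselect (simple_factor U W).
  exists 1%N => //; exists (fun i => if i == 0%N then U else W); split=> //.
    by case.
  by case.
have [X [smX sUX sXW nXU nWX]] : exists X : {pred V},
    [/\ submod_closed X, {subset U <= X}, {subset X <= W},
        ~ {subset X <= U} & ~ {subset W <= X}].
  apply: contrapT => nX; apply: nsimp; split=> // X smX sUX sXW.
  by apply: contrapT => /not_orP[nXU nWX]; apply: nX; exists X.
have ltUX := submod_rank_lt smU smX sUX nXU.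
have ltXW := submod_rank_lt smX smW sXW nWX.
have [|k1 ck1 /(_ nXU) k1_gt0] := IHN _ _ U X erefl smU smX sUX.
  by rewrite -En ltn_sub2r // (ltn_trans ltUX).
have [|k2 ck2 _] := IHN _ _ X W erefl smX smW sXW.
  by rewrite -En ltn_sub2l // (ltn_trans ltUX).
exists (k1 + k2)%N; first exact: factor_chain_cat ck1 ck2.
by rewrite ltn_addr.
Qed.

Section Endomorphism.
Variables (f : V -> V).
Hypotheses (fD : forall x y, f (x + y) = f x + f y)
  (fZ : forall a x, f (a *: x) = a *: f x)
  (kappaC : forall a b, kappa a * b = b * kappa a).
Implicit Types (l : seq K) (x y : V).

Definition shift_prod l x := foldr (fun a y => f y - kappa a *: y) x l.

Let f0 : f 0 = 0.
Proof. by apply: (addrI (f 0)); rewrite -fD !addr0. Qed.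

Let fN x : f (- x) = - f x.
Proof. by apply: (addrI (f x)); rewrite -fD !subrr. Qed.

Lemma shift_prod_linear l a x y :
  shift_prod l (a *: x + y) = a *: shift_prod l x + shift_prod l y.
Proof.
elim: l => //= b l ->; rewrite fD fZ scalerDr scalerBr opprD addrACA.
by rewrite !scalerA kappaC.
Qed.

Lemma shift_prod_shift l a x :
  shift_prod l (f x - kappa a *: x) =
  f (shift_prod l x) - kappa a *: shift_prod l x.
Proof.
elim: l => //= b l ->; rewrite !fD !fN !fZ !scalerBr !scalerA kappaC.
by rewrite !opprB addrACA [RHS]addrACA; congr (_ + _); rewrite addrC.
Qed.

Definition shift_image l : {pred V} := fun y => `[< exists x, y = shift_prod l x >].

Lemma shift_image_submod l : submod_closed (shift_image l).
Proof.
split=> [|a y z /asboolP[x ->] /asboolP[x' ->]]; apply/asboolP.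
  exists (0 : V); have := shift_prod_linear l (-1) 0 0.
  by rewrite !scaleN1r oppr0 addr0 addNr.
by exists (a *: x + x'); rewrite shift_prod_linear.
Qed.

Lemma shift_image_sub a l : {subset shift_image (a :: l) <= shift_image l}.
Proof.
move=> y /asboolP[x ->]; apply/asboolP; exists (f x - kappa a *: x).
by rewrite shift_prod_shift.
Qed.

Lemma shift_image_cons a l l' :
  shift_image l = shift_image l' -> shift_image (a :: l) = shift_image (a :: l').
Proof.
move=> ell'; apply/funext => y; apply/asbool_equiv_eq; split=> -[x ->] /=.
  have : shift_prod l x \in shift_image l' by rewrite -ell'; apply/asboolP; exists x.
  by case/asboolP=> x' ->; exists x'.
have : shift_prod l' x \in shift_image l by rewrite ell'; apply/asboolP; exists x.
by case/asboolP=> x' ->; exists x'.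
Qed.

(** [l'] keeps only the scalars at which the image strictly shrinks; dropping the others does not
    change the final image, and each one kept costs at least one factor. *)
Lemma shift_chain l : exists l' k,
  [/\ shift_image l = shift_image l', (size l' <= k)%N &
      factor_chain k (shift_image l) (fun=> true)].
Proof.
elim: l => [|a l [l' [k [ell' sl' ck]]]].
  exists [::], 0%N; split=> //; exists (fun=> fun=> true); split=> //.
  by apply/funext => y; apply/esym/asboolP; exists y.
have smI := shift_image_submod.
have sub : {subset shift_image (a :: l) <= shift_image l} by apply: shift_image_sub.
have [k' ck' k'_gt0] := submod_refine (smI _) (smI _) sub.
have [s|ns] := pselect {subset shift_image l <= shift_image (a :: l)}.
  have e : shift_image (a :: l) = shift_image l.
    by apply/funext => y; apply/idP/idP; [apply: sub | apply: s].
  by exists l', k; rewrite e.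
exists (a :: l'), (k' + k)%N; split; first exact: shift_image_cons.
  by rewrite /= -add1n leq_add // k'_gt0.
exact: factor_chain_cat ck' ck.
Qed.

(** Lift [f] to a matrix along [phi] and apply Cayley-Hamilton to its characteristic polynomial,
    which splits over [K]. *)
Lemma shift_prod_annihilator : exists l, forall x, shift_prod l x = 0.
Proof.
have [T Tf] : exists T : 'M[K]_d, forall v, phi (v *m T) = f (phi v).
  have /choice[g gf] i : exists v, f (phi (delta_mx 0 i)) = phi v by apply: phi_surj.
  exists (\matrix_i g i) => v.
  have phi_sum I (s : seq I) (h : I -> 'rV_d) :
      phi (\sum_(i <- s) h i) = \sum_(i <- s) phi (h i).
    exact: (big_morph phi phiD phi0).
  have f_sum I (s : seq I) (h : I -> V) :
      f (\sum_(i <- s) h i) = \sum_(i <- s) f (h i).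
    exact: (big_morph f fD f0).
  rewrite mulmx_sum_row phi_sum [in RHS](row_sum_delta v) phi_sum f_sum.
  by apply: eq_bigr => i _; rewrite !phiZ fZ gf rowK.
case: d phi phiD phiZ phi_surj phi0 T Tf => [|d'] ph phD phZ ph_surj ph0 T Tf.
  by exists [::] => x; have [v ->] := ph_surj x; rewrite thinmx0 ph0.
have [l lP] := closed_field_poly_normal (char_poly T).
have mT := char_poly_monic T; rewrite (monicP mT) scale1r in lP.
exists l => x; have [v ->] := ph_surj x.
suff -> : shift_prod l (ph v) = ph (v *m horner_mx T (\prod_(z <- l) ('X - z%:P))).
  by rewrite -lP Cayley_Hamilton mulmx0 ph0.
elim: l {lP} v => [|a l IHl] v; first by rewrite big_nil rmorph1 mulmx1.
rewrite /= IHl big_cons mulrC rmorphM /= mulmxA -Tf -phZ.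
have phN u : - ph u = ph (- u).
  by apply: (addrI (ph u)); rewrite -phD !subrr ph0.
rewrite phN -phD rmorphB /= horner_mx_X horner_mx_C.
by rewrite mulmxBr mul_mx_scalar.
Qed.

Lemma many_constituents N :
  (forall l, (size l <= N)%N -> exists x, shift_prod l x != 0) ->
  exists2 k, nb_constituents V k & (N < k)%N.
Proof.
move=> nz; have [l l0] := shift_prod_annihilator.
have image0 l' : (forall x, shift_prod l' x = 0) -> shift_image l' =i pred1 0.
  move=> l'0 y; apply/asboolP/eqP => [[x ->]//|->].
  by exists 0; rewrite l'0.
have [l' [k [ell' le_l'k [C [smC C0 Ck simC]]]]] := shift_chain l.
exists k.
  by exists C; split=> // [|y]; [rewrite C0; apply: image0 | rewrite Ck].
rewrite (leq_trans _ le_l'k) // ltnNge; apply/negP => /nz[x].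
suff /eqP-> : shift_prod l' x == 0 by rewrite eqxx.
suff : shift_prod l' x \in shift_image l by rewrite (image0 l l0).
by rewrite ell'; apply/asboolP; exists x.
Qed.

End Endomorphism.
End Length.

Lemma reducible_constituents (R : pzRingType) (V : lmodType R) k :
  nb_constituents V k -> (1 < k)%N -> reducible V.
Proof.
move=> [U [smU U0 _ simU]] k_gt1.
have [_ n10 _] := simU 0%N (ltnW k_gt1).
have [_ n21 _] := simU 1%N k_gt1.
exists (U 1%N); split; first exact/smU/ltnW.
  apply: contrapT => nu; apply: n10 => u uU; rewrite U0; apply: contrapT => /negP u0.
  by apply: nu; exists u.
apply: contrapT => nv; apply: n21 => v _; apply: contrapT => /negP vU.
by apply: nv; exists v.
Qed.

(** * The induced module *)

Local Notation ract := Defs.ract.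

Lemma ind_lift (A B : pzRingType) (f : A -> B) (M : lmodType A^c) (L : zmodType)
    (g : M -> B -> L) :
  (forall m m' b, g (m + m') b = g m b + g m' b) ->
  (forall m b b', g m (b + b') = g m b + g m b') ->
  (forall m a b, g (ract m a) b = g m (f a * b)) ->
  exists h : Ind f M -> L,
    (forall t u, h (t + u) = h t + h u) /\ forall m b, h (tens f m b) = g m b.
Proof.
move=> gDl gDr gbal; pose gg (p : M * B) : zmodule L := g p.1 p.2.
pose h0 : {freeg (M * B)%type / int} -> zmodule L := fglift gg.
have h0B : zmod_morphism h0 by apply: lift_is_additive.
have h0gen m b : h0 << (m, b) >> = g m b by rewrite /h0 liftU scale1r.
have h0D x y : h0 (x + y) = h0 x + h0 y.
  have h00 : h0 0 = 0 by have := h0B 0 0; rewrite !subrr.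
  have h0N z : h0 (- z) = - h0 z by rewrite -sub0r h0B h00 sub0r.
  by rewrite -{1}[y]opprK h0B h0N opprK.
have h0span x : x \in zspan (@tensor_rel A B f M) -> h0 x = 0.
  move=> /asboolP/(_ (fun x => `[< h0 x = 0 >])) h0x.
  apply/asboolP; apply: h0x.
    split=> [|y z /asboolP y0 /asboolP z0]; apply/asboolP.
      by have := h0B 0 0; rewrite !subrr.
    by rewrite h0B y0 z0 subrr.
  move=> _ [m m' b|m b b'|m a b]; apply/asboolP; rewrite !h0B !h0gen.
  - by rewrite gDl addrAC addrK subrr.
  - by rewrite gDr addrAC addrK subrr.
  by rewrite gbal subrr.
have h0pi x : h0 (ind_repr (ind_pi f x)) = h0 x.
  apply/eqP; rewrite -subr_eq0 -h0B; apply/eqP/h0span/ind_piP.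
  by rewrite ind_reprK.
exists (fun t => h0 (ind_repr t)); split=> [t u|m b]; last by rewrite h0pi.
by rewrite -[t]ind_reprK -[u]ind_reprK -raddfD !h0pi h0D.
Qed.

Section Cyclotomic.
Variables (K : closedFieldType) (n r : nat) (s : 'I_r -> int).
Variables (H : daha K n.+1) (H' : daha K n.+2).
Hypothesis r_gt0 : (0 < r)%N.
Local Notation A := (cyclotomic s H).
Local Notation B := (cyclotomic s H').
Local Notation f := (@cyclotomic_incl K r s n.+1 H H').
Local Notation GA := (@cyclotomic_rel K r s n.+1 H).
Local Notation GB := (@cyclotomic_rel K r s n.+2 H').
Local Notation piA := (rq_pi GA : H -> A).
Local Notation piB := (rq_pi GB : H' -> B).
Local Notation incl := (daha_incl H').
Local Notation pm := (daha_perm H').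
Local Notation T := (daha_pol H' 'X_ord_max).

Let q : {poly K} := \prod_(j < r) ('X - ((s j)%:~R)%:P).

Let q_monic : q \is monic.
Proof. exact: monic_prod_XsubC. Qed.

Let size_q : size q = r.+1.
Proof. by rewrite size_prod_XsubC /index_enum -enumT size_enum_ord. Qed.

Lemma cyclotomic_relE n' (L : daha K n'.+1) h :
  @cyclotomic_rel K r s n'.+1 L h <-> h = daha_cyc L q ord0.
Proof.
have cycE : daha_cyc L q ord0 = \prod_(j < r) (daha_pol L 'X_ord0 - (s j)%:~R).
  rewrite /daha_cyc rmorph_prod; apply: eq_bigr => j _.
  by rewrite rmorphB /= horner_algX horner_algC -in_algE rmorph_int.
split=> [[i i0 ->]|->]; last by exists ord0.
by rewrite cycE; have -> : i = ord0 by apply: val_inj.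
Qed.

Lemma cyc_in_ideal : daha_cyc H q ord0 \in ideal_gen GA.
Proof. by apply/ideal_gen_sub/cyclotomic_relE. Qed.

Lemma incl_ideal g : g \in ideal_gen GA -> incl g \in ideal_gen GB.
Proof.
pose U : {pred H} := fun g => incl g \in ideal_gen GB.
have UE y : (y \in U) = (incl y \in ideal_gen GB) by [].
move=> /asboolP/(_ U); rewrite UE; apply.
  split; first split=> [|x y].
  - by rewrite UE raddf0 rpred0.
  - by rewrite !UE raddfB; apply: rpredB.
  move=> a x; rewrite !UE !daha_inclM => Ix.
  by split; [apply: ideal_genMl | apply: ideal_genMr].
move=> _ /cyclotomic_relE->; rewrite UE -(daha_incl_cyc H H' q_monic size_q).
by apply/ideal_gen_sub/cyclotomic_relE.
Qed.

Lemma cyclotomic_incl_pi g : f (piA g) = piB (incl g).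
Proof.
apply/rq_piP; rewrite -raddfB; apply: incl_ideal; apply/rq_piP.
by rewrite rq_reprK.
Qed.

Lemma cyclotomic_incl_scalar k :
  f (cyclotomic_scalar s H k) = cyclotomic_scalar s H' k.
Proof. by rewrite cyclotomic_incl_pi linearZ rmorph1. Qed.

Lemma cyclotomic_scalarC k (b : B) :
  cyclotomic_scalar s H' k * b = b * cyclotomic_scalar s H' k.
Proof.
rewrite -[b]rq_reprK -[cyclotomic_scalar _ _ _ * _]rmorphM.
by rewrite -[X in _ = X]rmorphM mulr_algl mulr_algr.
Qed.

Lemma exists_cyclotomic_trace : exists tr : B -> A,
  [/\ forall b b', tr (b + b') = tr b + tr b',
      forall a b, tr (f a * b) = a * tr b &
      forall p : {poly K}, p \is monic -> size p = r.+1 ->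
        tr (piB (daha_cyc H' p ord_max)) = 1].
Proof.
have [c [cD cM cT cTr cF]] := exists_cyclotomic_functional H H' q_monic size_q r_gt0.
have c0 : c 0 = 0 by apply: (addrI (c 0)); rewrite -cD !addr0.
have cN y : c (- y) = - c y by apply: (addrI (c y)); rewrite -cD !subrr c0.
have c_ideal h : h \in ideal_gen GB -> c h \in ideal_gen GA.
  (* The elements whose two-sided multiples are all mapped into the ideal form a two-sided ideal, so
     it suffices to test the generator. *)
  move=> /asboolP/(_ (fun h => `[< forall y z, c (y * h * z) \in ideal_gen GA >])) ch.
  have /asboolP/(_ 1 1) : `[< forall y z, c (y * h * z) \in ideal_gen GA >].
    apply: ch.
      split; first split.
      - by apply/asboolP => y z; rewrite mulr0 mul0r c0 rpred0.
      - move=> x y /asboolP Ix /asboolP Iy; apply/asboolP => u v.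
        by rewrite mulrBr mulrBl cD cN rpredB.
      move=> a x /asboolP Ix; split; apply/asboolP => y z.
        by rewrite mulrA.
      by rewrite mulrA -(mulrA _ a).
    move=> _ /cyclotomic_relE->; apply/asboolP => y z.
    exact: (functional_cyc_ideal q_monic size_q cyc_in_ideal erefl cD cM cF).
  by rewrite mul1r mulr1.
pose tr (b : B) : A := piA (c (rq_repr b)).
have trE h : tr (piB h) = piA (c h).
  apply/rq_piP; rewrite -cN -cD; apply: c_ideal; apply/rq_piP.
  by rewrite rq_reprK.
exists tr; split=> [b b'|a b|p p_monic size_p].
- by rewrite -[b]rq_reprK -[b']rq_reprK -rmorphD !trE cD rmorphD.
- by rewrite -[a]rq_reprK -[b]rq_reprK cyclotomic_incl_pi -rmorphM !trE cM rmorphM.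
rewrite trE (daha_cycE _ p_monic size_p) cD cTr.
have -> : c (\sum_(b < r) p`_b *: T ^+ b) = 0.
  elim/big_rec: _ => [//|b y _ y0].
  by rewrite cD y0 addr0 -mulr_algl -(daha_incl1 H H') -daha_inclZ cM cT // mulr0.
by rewrite addr0 rmorph1.
Qed.

Section Induced.
Variable M : lmodType A^c.
Hypothesis M_fin : finite_dimensional M.
Local Notation V := (Ind f M).
Local Notation "m # b" := (tens f m b : V) (at level 40).
Local Notation kappa := (fun k => cyclotomic_scalar s H' k : B^c).
Implicit Types (m : M) (t : V) (b : B).

Let ractM m a a' : ract (ract m a) a' = ract m (a * a').
Proof. exact: scalerA. Qed.

Let tens0l b : 0 # b = 0.
Proof. by apply: (addrI (0 # b)); rewrite -tensDl !addr0. Qed.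

Let tens0r m : m # 0 = 0.
Proof. by apply: (addrI (m # 0)); rewrite -tensDr !addr0. Qed.

Let tensNr m b : m # (- b) = - (m # b).
Proof. by apply: (addrI (m # b)); rewrite -tensDr !subrr tens0r. Qed.

Let incl_lastC a : f a * piB T = piB T * f a.
Proof.
rewrite -[a]rq_reprK cyclotomic_incl_pi -[LHS]rmorphM -[RHS]rmorphM /=.
by rewrite daha_incl_lastC.
Qed.

(** Left multiplication by [T] is balanced because [T] commutes with the image of h_n. *)
Lemma ind_last_mul : exists g : V -> V,
  [/\ forall t u, g (t + u) = g t + g u,
      forall (a : B^c) t, g (a *: t) = a *: g t &
      forall m b, g (m # b) = m # (piB T * b)].
Proof.
have [||m a b|g [gD gE]] := @ind_lift A B f M V (fun m b => m # (piB T * b)).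
- by move=> m m' b; rewrite tensDl.
- by move=> m b b'; rewrite mulrDr tensDr.
- by rewrite tens_bal !mulrA incl_lastC.
have g0 : g 0 = 0 by apply: (addrI (g 0)); rewrite -gD !addr0.
have gN t : g (- t) = - g t by apply: (addrI (g t)); rewrite -gD !subrr g0.
exists g; split=> // a; apply: ind_tens_ind => [m b||t u gt gu].
- by rewrite gE ![a *: _]tens_scale gE mulrA.
- by rewrite scaler0 g0 scaler0.
by rewrite scalerBr !gD !gN scalerBr gt gu.
Qed.

Let cyc_zero h : h \in ideal_gen GB -> piB h = 0.
Proof. by move=> hI; rewrite -[RHS](rmorph0 piB); apply/rq_piP; rewrite subr0. Qed.

(** Division by F leaves the spanning vectors e_i (x) T^a w with a < r. *)
Lemma ind_finite : exists d (phi : 'rV[K]_d -> V),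
  [/\ forall u v, phi (u + v) = phi u + phi v,
      forall a v, phi (a *: v) = kappa a *: phi v &
      forall t, exists v, t = phi v].
Proof.
have [d0 [e eP]] := M_fin.
pose J : finType := ('I_d0 * 'I_r * 'S_n.+2)%type.
pose base (j : J) : V := e j.1.1 # piB (T ^+ j.1.2 * pm j.2).
pose phi (v : 'rV[K]_#|J|) : V := \sum_j kappa (v 0 (enum_rank j)) *: base j.
have phiD u v : phi (u + v) = phi u + phi v.
  rewrite -big_split; apply: eq_bigr => j _.
  rewrite -[RHS]scalerDl mxE; congr (_ *: _).
  by rewrite /cyclotomic_scalar scalerDl rmorphD.
have phiZ a v : phi (a *: v) = kappa a *: phi v.
  rewrite scaler_sumr; apply: eq_bigr => j _.
  rewrite scalerA; congr (_ *: _).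
  rewrite mxE; apply: etrans (cyclotomic_scalarC _ _).
  by rewrite /cyclotomic_scalar -rmorphM mulr_algl scalerA.
exists #|J|, phi; split=> //.
pose S t := exists v, t = phi v.
have SD t u : S t -> S u -> S (t + u) by move=> [v ->] [w ->]; exists (v + w).
have SZ a t : S t -> S (kappa a *: t) by move=> [v ->]; exists (a *: v).
have phi0 : phi 0 = 0 by apply: (addrI (phi 0)); rewrite -phiD !addr0.
have S0 : S 0 by exists 0.
have SN t : S t -> S (- t).
  move=> [v ->]; exists (- v); apply: (addrI (phi v)).
  by rewrite -phiD !subrr phi0.
have S_base j : S (base j).
  exists (delta_mx 0 (enum_rank j)); rewrite /phi (bigD1 j) //= big1 => [|i ij].
    by rewrite mxE !eqxx addr0 /cyclotomic_scalar scale1r rmorph1 scale1r.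
  rewrite mxE eqxx (inj_eq enum_rank_inj) (negPf ij).
  by rewrite /cyclotomic_scalar scale0r rmorph0 scale0r.
have S_low m a w : (a < r)%N -> S (m # piB (T ^+ a * pm w)).
  move=> ar; have [x ->] := eP m.
  elim/big_rec: _ => [|i y _ Sy]; first by rewrite tens0l.
  rewrite tensDl; apply: SD => //; rewrite tens_bal cyclotomic_incl_scalar.
  rewrite cyclotomic_scalarC -tens_scale.
  exact: (SZ _ _ (S_base (i, Ordinal ar, w))).
have [E LE FE] := conj_cyc_lower H' q_monic size_q r_gt0 ord_max.
have F_I : conj_cyc H' q ord_max \in ideal_gen GB.
  by apply/ideal_genMr/ideal_genMl/ideal_gen_sub/cyclotomic_relE.
have S_term a m (g : H) w : S (m # piB (incl g * T ^+ a * pm w)).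
  elim/ltn_ind: a m g w => a IHa m g w.
  rewrite -mulrA rmorphM /= -cyclotomic_incl_pi -tens_bal.
  move: (ract m _) => {}m.
  have [ar|ra] := ltnP a r; first exact: S_low.
  (* F vanishes in the quotient, and the remaining term has degree less than [a] in [T]. *)
  have -> : T ^+ a = T ^+ (a - r) * conj_cyc H' q ord_max - T ^+ (a - r) * E.
    by rewrite -mulrBr FE addrK -exprD subnK.
  rewrite mulrBl rmorphB /= tensDr tensNr cyc_zero ?tens0r ?add0r; last first.
    by apply/ideal_genMr/ideal_genMl.
  apply: SN; elim: LE => [|y z _ Sy _ Sz|p b u Bp br _].
  - by rewrite mulr0 mul0r rmorph0 tens0r.
  - by rewrite mulrDr mulrDl rmorphD tensDr; apply: SD.
  have [p' ->] := below_max_widen Bp.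
  rewrite -(@daha_incl_pol _ _ H) !mulrA daha_incl_lastXC -(mulrA (incl _)) -exprD.
  rewrite -(mulrA _ (pm u)) -daha_permM; apply: IHa.
  by rewrite -ltn_subRL (leq_trans br) // subKn.
apply: ind_tens_ind => [m b||t u St Su]; last 2 first.
- exact: S0.
- by apply: SD => //; apply: SN.
rewrite -[b]rq_reprK; elim/(@daha_incl_ind _ _ H): (rq_repr b) => [y z Sy Sz|p a w].
  by rewrite rmorphD tensDr; apply: SD.
exact: S_term.
Qed.

Lemma shift_prod_neq0 (g : V -> V) l m :
  (forall m b, g (m # b) = m # (piB T * b)) -> m != 0 -> (size l <= r)%N ->
  exists t, shift_prod kappa g l t != 0.
Proof.
move=> gE m0 le_lr; pose P l := \prod_(a <- l) ('X - a%:P) : {poly K}.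
have shift_tens h : shift_prod kappa g l (m # piB h) =
    m # piB (horner_alg T (P l) * h).
  elim: (l) => [|a l' /= ->]; first by rewrite /P big_nil rmorph1 mul1r.
  rewrite gE [_ *: _]tens_scale -tensNr -tensDr -cyclotomic_scalarC.
  rewrite -[piB T * _]rmorphM -[cyclotomic_scalar _ _ _ * _]rmorphM -rmorphB.
  congr (_ # piB _); rewrite /P big_cons rmorphM rmorphB /= horner_algX.
  by rewrite horner_algC -mulrA mulrBl.
have [tr [trD trM tr1]] := exists_cyclotomic_trace.
have [||m' a b|d [dD dE]] := @ind_lift A B f M M (fun m b => ract m (tr b)).
- by move=> m1 m2 b; apply: scalerDr.
- by move=> m' b b'; rewrite trD; apply: scalerDl.
- by rewrite trM ractM.
have d0 : d 0 = 0 by apply: (addrI (d 0)); rewrite -dD !addr0.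
(* The power of [T] pads the product of the factors to a monic polynomial of degree exactly r, on
   which [tr] is 1; hence [d] sends the shifted vector to [m]. *)
exists (m # piB (T ^+ (r - size l))); apply: contra_neq m0 => shift0.
rewrite -d0 -shift0 shift_tens dE.
have -> : horner_alg T (P l) * T ^+ (r - size l) =
    daha_cyc H' (P l * 'X^(r - size l)) ord_max.
  by rewrite /daha_cyc rmorphM rmorphXn /= horner_algX.
have mP : P l \is monic by apply: monic_prod_XsubC.
rewrite tr1; first by rewrite [RHS]scale1r.
  by rewrite monicMl // monicXn.
rewrite size_Mmonic ?monicXn ?monic_neq0 // size_polyXn size_prod_XsubC.
by rewrite addnS /= addSn subnKC.
Qed.

End Induced.
End Cyclotomic.

Theorem theorem2p29 (K : closedFieldType) (n r : nat) (s : 'I_r -> int)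
    (H : daha K n) (H' : daha K n.+1) (M : lmodType (cyclotomic s H)^c)
    (n_gt0 : (0 < n)%N) (r_gt0 : (0 < r)%N)
    (s_ge0 : forall j, 0 <= s j)
    (s_mono : forall i j : 'I_r, (i <= j)%N -> s i <= s j)
    (s_lt_e : forall j, lt_char K (s j))
    (M_fin : finite_dimensional M) (M_neq0 : exists m : M, m != 0) :
  (exists2 k, nb_constituents (Ind (@cyclotomic_incl K r s n H H') M) k
            & (r.+1 <= k)%N)
  /\ reducible (Ind (@cyclotomic_incl K r s n H H') M).
Proof.
case: n n_gt0 H H' M M_fin M_neq0 => // n _ H H' M M_fin [m m0].
have [d [phi [phiD phiZ phi_surj]]] := ind_finite H' r_gt0 M_fin.
have [g [gD gZ gE]] := ind_last_mul H' M.
have kappaC a (b : (cyclotomic s H')^c) :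
    (cyclotomic_scalar s H' a : (cyclotomic s H')^c) * b =
    b * cyclotomic_scalar s H' a.
  exact/esym/cyclotomic_scalarC.
have nz l : (size l <= r)%N ->
    exists t, shift_prod (fun k => cyclotomic_scalar s H' k : (cyclotomic s H')^c)
      g l t != 0.
  exact: (shift_prod_neq0 r_gt0 gE m0).
have [k Vk lt_rk] := many_constituents phiD phiZ phi_surj gD gZ kappaC nz.
split; first by exists k.
by apply: reducible_constituents Vk _; apply: leq_ltn_trans lt_rk.
Qed.
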